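(* Let $(A,\mathfrak m)$ be a Noetherian local ring, $B$ a commutative ring with unity, $f:A\to B$ a ring homomorphism, and $J$ an ideal of $B$ contained in the Jacobson radical of $B$, such that the ring $A\bowtie^f J$ is Noetherian. Assume that $f^{-1}(\mathfrak q)\neq\mathfrak m$ for each $\mathfrak q\in\operatorname{Spec}(B)\setminus V(J)$. Then: (1) If $A\bowtie^f J$ is Cohen-Macaulay, then $A$ is Cohen-Macaulay. (2) Assume further that $\operatorname{depth}_A J<\infty$. Then $A\bowtie^f J$ is Cohen-Macaulay if and only if $A$ is Cohen-Macaulay and $J$ is a big Cohen-Macaulay $A$-module.
   Context: For a ring homomorphism $f:A\to B$ of commutative rings and an ideal $J$ of $B$, the amalgamation is the subring $A\bowtie^f J:=\{(a,f(a)+j)\mid a\in A,\ j\in J\}$ of $A\times B$. The ideal $J$ is regarded as an $A$-module via $f$. $V(J)$ denotes the set of prime ideals of $B$ containing $J$. For a Noetherian local ring $(A,\mathfrak m)$ and an arbitrary (not necessarily finitely generated) $A$-module $N$, $\operatorname{depth}_A N:=\inf\{i\mid H^i_{\mathfrak m}(N)\neq 0\}$, where $H^i_{\mathfrak m}$ is local cohomology (so the depth is $\infty$ if all these modules vanish). An $A$-module $N$ is called big Cohen-Macaulay if $\operatorname{depth}_A N=\dim A$. *)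

(* Defs.v *)
From HB Require Import structures.
From mathcomp Require Import all_boot all_order all_algebra.
From mathcomp Require Import boolp classical_sets constructive_ereal.

Set Implicit Arguments.
Unset Strict Implicit.
Unset Printing Implicit Defensive.

Import GRing.Theory.
Local Open Scope ring_scope.
Local Open Scope classical_set_scope.

(* Rings are comPzRingType throughout, so that the zero ring is allowed (as it
   is for B); the ideals of ring_quotient are boolean, proper, and restricted
   to nontrivial rings, hence the following set-based notions. *)
Section Ideals.
Variable R : comPzRingType.
Implicit Types I m p q : set R.

Definition ideal I : Prop :=
  [/\ I 0, (forall x y, I x -> I y -> I (x + y))
         & (forall a x, I x -> I (a * x))].

Definition prime_ideal p : Prop :=
  [/\ ideal p, ~ p 1 & forall x y, p (x * y) -> p x \/ p y].

Definition maximal_ideal m : Prop :=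
  [/\ ideal m, ~ m 1 &
      forall I, ideal I -> ~ I 1 -> m `<=` I -> I = m].

Definition Spec : set (set R) := [set p | prime_ideal p].

Definition Vset I : set (set R) := [set p | prime_ideal p /\ I `<=` p].

Definition jacobson_radical : set R :=
  [set x | forall m, maximal_ideal m -> m x].

Definition span_ideal (s : seq R) : set R :=
  [set x | exists c : nat -> R, x = \sum_(i < size s) c i * s`_i].

Definition noetherian : Prop :=
  forall I, ideal I -> exists s : seq R, I = span_ideal s.

(* R is local with maximal ideal m. *)
Definition local_ring m : Prop :=
  maximal_ideal m /\ (forall m', maximal_ideal m' -> m' = m).

Definition ideal_mul I1 I2 : set R :=
  [set x | exists s : seq (R * R),
     (forall u, u \in s -> I1 u.1 /\ I2 u.2) /\ x = \sum_(u <- s) u.1 * u.2].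

Definition ideal_exp I (n : nat) : set R := iter n (ideal_mul I) setT.

End Ideals.

Arguments Spec R : clear implicits.
Arguments jacobson_radical R : clear implicits.

(* Infimum and supremum of a set of natural numbers, with inf of the empty set
   +oo and sup of the empty set -oo. *)
Definition inf_nat (P : set nat) : \bar nat :=
  if pselect (exists n, `[< P n >]) is left exP then (ex_minn exP)%:E%E
  else +oo%E.

Definition sup_nat (P : set nat) : \bar nat :=
  if pselect (exists n, P n) then
    inf_nat [set b | forall n, P n -> (n <= b)%N]
  else -oo%E.

(* n is the length of a chain p 0 < ... < p n; the values of p beyond n are
   irrelevant. *)
Definition prime_chain (R : comPzRingType) (n : nat) : Prop :=
  exists p : nat -> set R,
    (forall i, (i <= n)%N -> prime_ideal (p i)) /\
    (forall i, (i < n)%N -> p i `<` p i.+1).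

Definition krull_dim (R : comPzRingType) : \bar nat :=
  sup_nat [set n | prime_chain R n].

Section LocalCohomology.
Variable A : comPzRingType.

Definition injective_module (E : lmodType A) : Prop :=
  forall (X Y : lmodType A) (i : {linear X -> Y}) (g : {linear X -> E}),
    injective i -> exists h : {linear Y -> E}, forall x, h (i x) = g x.

Record injective_resolution (N : lmodType A) := InjectiveResolution {
  res_obj : nat -> lmodType A;
  res_aug : {linear N -> res_obj 0};
  res_diff : forall i, {linear res_obj i -> res_obj i.+1};
  res_injective : forall i, injective_module (res_obj i);
  res_aug_inj : injective res_aug;
  res_exact0 : forall x, res_diff 0 x = 0 <-> exists y, res_aug y = x;
  res_exactS : forall i x,
    res_diff i.+1 x = 0 <-> exists y, res_diff i y = x }.

Definition torsion (m : set A) (N : lmodType A) : set N :=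
  [set x | exists n, forall a, ideal_exp m n a -> a *: x = 0].

Definition cocycles (m : set A) (N : lmodType A) (E : injective_resolution N)
    (i : nat) : set (res_obj E i) :=
  [set x | torsion m x /\ res_diff E i x = 0].

Definition coboundaries (m : set A) (N : lmodType A)
    (E : injective_resolution N) (i : nat) : set (res_obj E i) :=
  match i with
  | 0 => [set 0]
  | j.+1 => [set res_diff E j y | y in torsion m (N := res_obj E j)]
  end.

Arguments cocycles m {N} E i _.
Arguments coboundaries m {N} E i _.

(* H^i_m(N) is the i-th right derived functor of the m-torsion functor,
   computed on an injective resolution of N; up to isomorphism it does not
   depend on the resolution, so "some" and "every" agree here. *)
Definition local_cohomology_neq0 (m : set A) (N : lmodType A) (i : nat) : Prop :=
  exists E : injective_resolution N,
    ~ (cocycles m E i `<=` coboundaries m E i).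

Definition depth (m : set A) (N : lmodType A) : \bar nat :=
  inf_nat [set i | local_cohomology_neq0 m N i].

Definition big_cohen_macaulay (m : set A) (N : lmodType A) : Prop :=
  depth m N = krull_dim A.

End LocalCohomology.

(* Cohen-Macaulayness of a (Noetherian) local ring; a ring which is not
   Noetherian local does not satisfy this predicate. *)
Definition cohen_macaulay (R : comPzRingType) : Prop :=
  noetherian R /\
  exists m : set R, local_ring m /\ depth m (R^o : lmodType R) = krull_dim R.

Section AmalgamationDefs.
Variables (A B : comPzRingType) (f : {rmorphism A -> B}) (J : set B).

Definition amalg_set : set (A * B) :=
  [set (a, f a + j) | a in [set: A] & j in J].

Definition amalg_pred : {pred A * B} := fun u => u \in amalg_set.

Definition ideal_pred : {pred B} := fun x => x \in J.

(* The proof that J is an ideal, and f in the case of ideal_module, are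
   parameters of the carriers only so that the ring structure of amalgamation
   and the A-module structure of ideal_module can be inferred from them. *)
Definition amalgamation of ideal J : Type := {u : A * B | u \in amalg_pred}.

Definition ideal_module of {rmorphism A -> B} & ideal J : Type :=
  {x : B | x \in ideal_pred}.

End AmalgamationDefs.

Section AmalgamationTheory.
Variables (A B : comPzRingType) (f : {rmorphism A -> B}).
Variables (J : set B) (hJ : ideal J).
Local Notation amalg_pred := (amalg_pred f J).
Local Notation ideal_pred := (ideal_pred J).
Local Notation amalgamation := (amalgamation f hJ).
Local Notation ideal_module := (ideal_module f hJ).

Let idealN (x : B) : J x -> J (- x).
Proof. by case: hJ => _ _ JM Jx; rewrite -mulN1r; apply: JM. Qed.

Let amalgP u : reflect (J (u.2 - f u.1)) (u \in amalg_pred).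
Proof.
apply: (iffP idP).
  by rewrite unfold_in => /set_mem [a _ [j Jj <-]] /=; rewrite addrC addKr.
move=> Ju; rewrite unfold_in; apply/mem_set.
by exists u.1 => //; exists (u.2 - f u.1) => //; rewrite addrC subrK -surjective_pairing.
Qed.

Lemma amalg_subring_closed : subring_closed amalg_pred.
Proof.
case: (hJ) => J0 JD JM; split.
- by apply/amalgP; rewrite /= rmorph1 subrr.
- move=> u v /amalgP Ju /amalgP Jv; apply/amalgP => /=.
  rewrite rmorphB [X in J X](_ : _ = (u.2 - f u.1) + - (v.2 - f v.1)).
    exact/JD/idealN.
  by rewrite !opprD !opprK addrACA.
- move=> u v /amalgP Ju /amalgP Jv; apply/amalgP => /=.
  rewrite rmorphM [X in J X](_ : _ =
    u.2 * (v.2 - f v.1) + f v.1 * (u.2 - f u.1)).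
    by apply: JD; apply: JM.
  by rewrite !mulrBr [f v.1 * u.2]mulrC [f v.1 * f u.1]mulrC addrA subrK.
Qed.

HB.instance Definition _ := SubChoice.on amalgamation.
HB.instance Definition _ :=
  GRing.SubChoice_isSubComPzRing.Build (A * B)%type amalg_pred amalgamation
    amalg_subring_closed.

Lemma ideal_zmod_closed : zmod_closed ideal_pred.
Proof.
case: (hJ) => J0 JD _; split; first exact/mem_set.
move=> x y /set_mem Jx /set_mem Jy; apply/mem_set.
exact/JD/idealN.
Qed.

HB.instance Definition _ := SubChoice.on ideal_module.
HB.instance Definition _ := 
  GRing.SubChoice_isSubZmodule.Build B ideal_pred ideal_module
    ideal_zmod_closed.

Lemma ideal_scale_subproof (a : A) (x : ideal_module) :
  f a * val x \in ideal_pred.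
Proof.
by case: (hJ) => _ _ JM; apply/mem_set/JM/set_mem; exact: (valP x).
Qed.

Definition ideal_scale (a : A) (x : ideal_module) : ideal_module :=
  Sub (f a * val x) (ideal_scale_subproof a x).

Fact ideal_scaleA (a b : A) (x : ideal_module) :
  ideal_scale a (ideal_scale b x) = ideal_scale (a * b) x.
Proof. by apply: val_inj; rewrite !SubK rmorphM mulrA. Qed.

Fact ideal_scale1 : left_id 1 ideal_scale.
Proof. by move=> x; apply: val_inj; rewrite SubK rmorph1 mul1r. Qed.

Fact ideal_scaleDr : right_distributive ideal_scale +%R.
Proof.
by move=> a x y; apply: val_inj; rewrite SubK !raddfD /= mulrDr.
Qed.

Fact ideal_scaleDl (x : ideal_module) :
  {morph ideal_scale^~ x : a b / a + b}.
Proof.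
by move=> a b; apply: val_inj; rewrite SubK rmorphD mulrDl raddfD.
Qed.

HB.instance Definition _ := GRing.Zmodule_isLmodule.Build A ideal_module
  ideal_scaleA ideal_scale1 ideal_scaleDr ideal_scaleDl.

End AmalgamationTheory.

(* Main.v *)
(* Write R for the amalgamation and n for its ideal of pairs with first component
   in m. The hypothesis on Spec B makes n the only prime of R over
   m R. As an A-module R is the direct sum of A and J, so a sequence in m is
   regular on R if and only if it is regular on A and on J.

   Depth of a module N is linked to regular sequences xs in m which are regular
   on both A and N. For an injective resolution E of N, the complex
   Hom(A / xs A, E) then has cohomology N / xs N in degree k = length xs and zero
   elsewhere: exactness below k gives depth N >= k; if the depth exceeds k then
   N / xs N has no socle, so that prime avoidance extends xs when N = R, or when
   N ranges over A and J; exactness above k shows that depth N is at most k or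
   infinite as soon as A / xs A is Artinian. Regular sequences in m yield chains
   of primes of the same length, and Krull's height theorem bounds dim R by the
   length of a sequence xs with n minimal over xs R. *)
Require Import Defs.
From HB Require Import structures.
From mathcomp Require Import all_boot all_order all_algebra.
From mathcomp Require Import boolp classical_sets constructive_ereal.
From mathcomp Require Import functions ring.

Set Implicit Arguments.
Unset Strict Implicit.
Unset Printing Implicit Defensive.

Import GRing.Theory.
Local Open Scope ring_scope.
Local Open Scope classical_set_scope.

(** * Noetherian commutative rings *)

(** Zero divisors are therefore controlled in R, which is Noetherian: modulo xs R there are only
    finitely many maximal annihilators, and their preimages in A are avoided; an element annihilated
    by m then splits into its components in A and J. [regular] means weak regularity, which allows N
    = xs N, because J may be zero. Regular sequences do not exclude a depth beyond the dimension,
    they only show that it is infinite; here the finiteness of depth_A J enters.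

    Nonvanishing of local cohomology refers to some injective resolution, so a lower bound on the
    depth quantifies over all of them, and a resolution has to be built to exploit such a bound.
    Long exact sequences are replaced by linear contractions: for a subfunctor F of the identity, a
    contraction of F(E) in low degrees acts on every smaller subfunctor. Depth and dimension are
    compared through the sets of their lower bounds, which treats infinite values uniformly. *)

Section NoetherianRings.
Variable R : comPzRingType.
Implicit Types (I K P Q : set R) (S : set R) (s xs : seq R).

Lemma idealN I x : ideal I -> I x -> I (- x).
Proof. by case=> _ _ IM Ix; rewrite -mulN1r; apply: IM. Qed.

Lemma idealB I x y : ideal I -> I x -> I y -> I (x - y).
Proof. by move=> hI Ix Iy; case: (hI) => _ ID _; apply/ID => //; apply: idealN. Qed.

Lemma idealDl I x y : ideal I -> I y -> I (x + y) -> I x.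
Proof. by move=> hI Iy Ixy; rewrite -(addrK y x); apply: idealB. Qed.

Lemma ideal_mulr a I x : ideal I -> I x -> I (x * a).
Proof. by case=> _ _ IM Ix; rewrite mulrC; apply: IM. Qed.

Lemma primeM P a b : prime_ideal P -> ~ P a -> ~ P b -> ~ P (a * b).
Proof. by case=> _ _ PM Pa Pb /PM []. Qed.

Lemma primeX P a n : prime_ideal P -> P (a ^+ n) -> P a.
Proof.
case=> _ P1 PM; elim: n => [|n IHn]; first by rewrite expr0.
by rewrite exprS => /PM [].
Qed.

Definition colon I (u : R) : set R := [set x | I (x * u)].

Lemma colon_ideal I u : ideal I -> ideal (colon I u).
Proof.
case=> I0 ID IM; split; rewrite /colon /=.
- by rewrite mul0r.
- by move=> x y; rewrite mulrDl; apply: ID.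
- by move=> a x; rewrite -mulrA; apply: IM.
Qed.

Definition adjoin I (a : R) : set R := [set x | exists i c, I i /\ x = i + c * a].

Lemma adjoin_ideal I a : ideal I -> ideal (adjoin I a).
Proof.
case=> I0 ID IM; split.
- by exists 0, 0; rewrite mul0r addr0.
- move=> _ _ [i [c [Ii ->]]] [j [d [Ij ->]]].
  by exists (i + j), (c + d); split; [exact: ID | rewrite mulrDl addrACA].
- move=> b _ [i [c [Ii ->]]]; exists (b * i), (b * c).
  by split; [exact: IM | rewrite mulrDr mulrA].
Qed.

Lemma sub_adjoin I a : I `<=` adjoin I a.
Proof. by move=> x Ix; exists x, 0; rewrite mul0r addr0. Qed.

Lemma adjoin_mem I a : ideal I -> adjoin I a a.
Proof. by case=> I0 _ _; exists 0, 1; rewrite mul1r add0r. Qed.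

Lemma proper_adjoin I a : ideal I -> ~ I a -> I `<` adjoin I a.
Proof.
by move=> hI Ia; split; [exact: sub_adjoin | move/(_ a (adjoin_mem a hI))].
Qed.

Hypothesis Rnoeth : noetherian R.

Lemma noetherian_fg I : ideal I -> exists2 s : seq R,
  (forall x, x \in s -> I x) &
  (forall K, ideal K -> (forall x, x \in s -> K x) -> I `<=` K).
Proof.
move=> hI; have [s Is] := Rnoeth hI; exists s.
  move=> x xs; rewrite Is; exists (fun i => (i == index x s)%:R).
  have si : (index x s < size s)%N by rewrite index_mem.
  rewrite (bigD1 (Ordinal si)) //= eqxx mul1r nth_index // big1 ?addr0 //.
  by move=> j; rewrite -val_eqE /= => /negbTE ->; rewrite mul0r.
move=> K [K0 KD KM] sK x; rewrite Is => -[c ->].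
by elim/big_ind: _ => // i _; apply/KM/sK/mem_nth.
Qed.

(** Otherwise dependent choice yields a strictly increasing chain of ideals violating [Phi]; its
    union is generated by finitely many elements, all present at some stage N, which contradicts the
    strict inclusion of stage N in stage N+1. *)
Lemma noeth_ind (Phi : set R -> Prop) :
  (forall I, ideal I -> (forall K, ideal K -> I `<` K -> Phi K) -> Phi I) ->
  forall I, ideal I -> Phi I.
Proof.
move=> step I hI; apply: contrapT => nI.
pose bad := {I : set R | ideal I /\ ~ Phi I}.
have next (b : bad) : exists b' : bad, sval b `<` sval b'.
  case: b => K [hK nK] /=; apply: contrapT => nex; apply/nK/step => // L hL KL.
  apply: contrapT => nL; apply: nex.
  by exists (exist _ L (conj hL nL)).
have [nx nxP] := choice next.
pose c n := iter n nx (exist _ I (conj hI nI) : bad).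
have cS n : sval (c n) `<` sval (c n.+1) by rewrite /c /=; apply: nxP.
have cle i j : (i <= j)%N -> sval (c i) `<=` sval (c j).
  move=> /subnK <-; elim: (j - i)%N => [|k IHk]; first by rewrite add0n.
  by rewrite addSn; apply: subset_trans IHk _; case: (cS (k + i)%N).
pose U : set R := [set x | exists n, sval (c n) x].
have hU : ideal U.
  split; first by exists 0%N; case: (hI).
    move=> x y [n cx] [k cy]; exists (maxn n k).
    case: (svalP (c (maxn n k))) => -[_ cD _] _; apply: cD.
      by apply: cle cx; rewrite leq_maxl.
    by apply: cle cy; rewrite leq_maxr.
  move=> a x [n cx]; exists n.
  by case: (svalP (c n)) => -[_ _ cM] _; apply: cM.
have [s sU Us] := noetherian_fg hU.
have [N sN] : exists N, forall x, x \in s -> sval (c N) x.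
  elim: s sU {Us} => [|y s IHs] sU; first by exists 0%N.
  have [|N sN] := IHs; first by move=> x xs; apply: sU; rewrite in_cons xs orbT.
  have [k cy] := sU y (mem_head _ _).
  exists (maxn N k) => x; rewrite in_cons => /orP [/eqP ->|/sN].
    by apply: cle cy; rewrite leq_maxr.
  by apply: cle; rewrite leq_maxl.
have [hN _] := svalP (c N).
have [_] := cS N; apply=> x cx.
by apply: (Us _ hN sN); exists N.+1.
Qed.

(** If I is not prime, say ab in I, then I + (a) or I + (b) still misses S: otherwise the product of
    two elements of S, one from each, would lie in I. *)
Lemma prime_avoiding I S : ideal I -> S 1 ->
  (forall x y, S x -> S y -> S (x * y)) -> (forall x, S x -> ~ I x) ->
  exists P, [/\ prime_ideal P, I `<=` P & forall x, S x -> ~ P x].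
Proof.
move=> hI S1 SM; move: I hI; apply: noeth_ind => I hI IH SI.
have [pI|npI] := pselect (prime_ideal I); first by exists I; split.
have [a [b [Ia Ib Iab]]] : exists a b, [/\ ~ I a, ~ I b & I (a * b)].
  apply: contrapT => nab; apply: npI; split => //; first exact: SI.
  move=> a b Iab; have [Ia|Ia] := pselect (I a); first by left.
  right; apply: contrapT => Ib; apply: nab; by exists a, b.
have grow c : ~ I c -> (forall x, S x -> ~ adjoin I c x) ->
    exists P, [/\ prime_ideal P, I `<=` P & forall x, S x -> ~ P x].
  move=> Ic Sc.
  have [P [pP IP SP]] := IH _ (adjoin_ideal c hI) (proper_adjoin hI Ic) Sc.
  by exists P; split => //; apply: subset_trans IP; apply: sub_adjoin.
apply: contrapT => nP.
have meet c : ~ I c -> exists2 x, S x & adjoin I c x.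
  move=> Ic; apply: contrapT => nx; apply/nP/(grow c Ic) => x Sx cx.
  by apply: nx; exists x.
have [x Sx [i [c [Ii xE]]]] := meet a Ia.
have [y Sy [j [d [Ij yE]]]] := meet b Ib.
apply: (SI (x * y)); first exact: SM.
case: (hI) => _ ID IM.
rewrite xE yE mulrDl; apply: (ID _ _ (ideal_mulr _ hI Ii)).
rewrite mulrDr; apply: ID; first exact: IM.
by rewrite mulrACA; apply: IM.
Qed.

(** The colon ideals of such u are the maximal annihilators of nonzero elements of R / I; they are
    associated primes and cover the zero divisors modulo I. *)
Definition maxcolon I (u : R) : Prop :=
  ~ I u /\ forall v, ~ I v -> colon I u `<=` colon I v -> colon I v `<=` colon I u.

Lemma maxcolon_ex I v : ideal I -> ~ I v ->
  exists2 u, maxcolon I u & colon I v `<=` colon I u.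
Proof.
move=> hI; move: (colon_ideal v hI) {-2}(colon I v) (erefl (colon I v)) => _ K.
move=> KE; have hK : ideal K by rewrite KE; apply: colon_ideal.
(* The induction runs over the colon ideal K, with v varying along with it. *)
move: K hK v KE; apply: noeth_ind => K hK IH v KE Iv.
have [mv|nmv] := pselect (maxcolon I v); first by exists v; rewrite ?KE.
have [w [Iw vw wv]] : exists w, [/\ ~ I w, colon I v `<=` colon I w &
    ~ colon I w `<=` colon I v].
  apply: contrapT => nw; apply: nmv; split => // w Iw vw.
  by apply: contrapT => wv; apply: nw; exists w.
have [|u mu wu] := IH _ (colon_ideal w hI) _ w erefl Iw.
  by rewrite KE; split.
by exists u => //; rewrite KE; apply: subset_trans wu.
Qed.

(** If abu is in I and bu is not, the colon ideal of bu contains that of u; by maximality both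
    agree, and a belongs to them. *)
Lemma maxcolon_prime I u : ideal I -> maxcolon I u -> prime_ideal (colon I u).
Proof.
move=> hI [Iu mu]; split; first exact: colon_ideal.
  by rewrite /colon /= mul1r.
move=> a b; rewrite /colon /= -mulrA => Iabu.
have [Ibu|Ibu] := pselect (I (b * u)); first by right.
left; apply: (mu (b * u) Ibu) => //.
by rewrite /colon => x /= Ixu; rewrite mulrCA; case: (hI) => _ _; apply.
Qed.

End NoetherianRings.

(** * Submodules xs N and regular sequences *)

Section RegularSequences.
Variable A : comPzRingType.

Definition submodule (N : lmodType A) (K : set N) : Prop :=
  [/\ K 0, (forall x y, K x -> K y -> K (x + y)) & forall a x, K x -> K (a *: x)].

Variable N : lmodType A.
Implicit Types (K : set N) (xs : seq A).

Lemma submoduleN K x : submodule K -> K x -> K (- x).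
Proof. by case=> _ _ KZ Kx; rewrite -scaleN1r; apply: KZ. Qed.

Lemma submoduleB K x y : submodule K -> K x -> K y -> K (x - y).
Proof. by move=> hK Kx Ky; case: (hK) => _ KD _; apply/KD => //; apply: submoduleN. Qed.

Fixpoint spanmod xs : set N :=
  if xs is x :: xs' then [set y | exists u v, spanmod xs' v /\ y = x *: u + v]
  else [set 0].

Lemma spanmod_submodule xs : submodule (spanmod xs).
Proof.
elim: xs => [|x xs [s0 sD sZ]] /=.
  by split=> // [_ _ -> ->|a _ ->]; rewrite ?addr0 ?scaler0.
split.
- by exists 0, 0; rewrite scaler0 addr0.
- move=> _ _ [u [v [sv ->]]] [u' [v' [sv' ->]]]; exists (u + u'), (v + v').
  by split; [exact: sD | rewrite scalerDr addrACA].
- move=> a _ [u [v [sv ->]]]; exists (a *: u), (a *: v).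
  by split; [exact: sZ | rewrite scalerDr !scalerA mulrC].
Qed.

Lemma spanmod0 xs : spanmod xs 0.
Proof. by case: (spanmod_submodule xs). Qed.

Lemma spanmodD xs x y : spanmod xs x -> spanmod xs y -> spanmod xs (x + y).
Proof. by case: (spanmod_submodule xs) => _ sD _; apply: sD. Qed.

Lemma spanmodZ xs a x : spanmod xs x -> spanmod xs (a *: x).
Proof. by case: (spanmod_submodule xs) => _ _; apply. Qed.

Lemma spanmod_cons x xs : spanmod xs `<=` spanmod (x :: xs).
Proof. by move=> v sv; exists 0, v; rewrite scaler0 add0r. Qed.

Lemma mem_spanmod x xs u : x \in xs -> spanmod xs (x *: u).
Proof.
elim: xs => // y xs IHxs; rewrite in_cons => /orP [/eqP <-|/IHxs].
  by exists u, 0; rewrite addr0; split=> //; apply: spanmod0.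
exact: spanmod_cons.
Qed.

Lemma spanmod_sub K xs :
  submodule K -> (forall x u, x \in xs -> K (x *: u)) -> spanmod xs `<=` K.
Proof.
case=> K0 KD KZ; elim: xs => [|x xs IHxs] Kxs y /=; first by move=> ->.
move=> [u [v [/IHxs Kv ->]]]; apply: KD.
  by apply: Kxs; rewrite mem_head.
by apply: Kv => z w zxs; apply: Kxs; rewrite in_cons zxs orbT.
Qed.

(* The sequence is listed backwards: the head is a nonzerodivisor modulo the
   tail. *)
Fixpoint regular xs : Prop :=
  if xs is x :: xs' then
    regular xs' /\ forall y, spanmod xs' (x *: y) -> spanmod xs' y
  else True.

End RegularSequences.

Arguments spanmod {A} N xs _.
Arguments regular {A} N xs.

(** * Chains of primes and regular sequences *)

Section PrimeChains.
Variable R : comPzRingType.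
Hypothesis Rnoeth : noetherian R.
Implicit Types (I K P Q : set R) (xs : seq R).

Lemma ideal_span xs : ideal (spanmod R^o xs).
Proof. exact: (spanmod_submodule R^o xs). Qed.

(** That is, P has height at least n; naming the last prime lets chains be extended upwards. *)
Definition chain_to n P : Prop :=
  exists p : nat -> set R, [/\ forall i, (i <= n)%N -> prime_ideal (p i),
    forall i, (i < n)%N -> p i `<` p i.+1 & p n = P].

Lemma chain_to_prime n P : chain_to n P -> prime_ideal P.
Proof. by case=> p [pp _ <-]; apply: pp. Qed.

Lemma chain_to0 P : prime_ideal P -> chain_to 0 P.
Proof. by move=> pP; exists (fun=> P); split. Qed.

Lemma chain_toS n P : chain_to n.+1 P <->
  prime_ideal P /\ exists2 Q, chain_to n Q & Q `<` P.
Proof.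
split=> [[p [pp ps <-]]|[pP [Q [p [pp ps pQ]] QP]]].
  split; first exact: pp.
  exists (p n); last exact: ps.
  exists p; split=> // i ni; [apply: pp; exact: leqW | apply: ps; exact: ltnW].
exists (fun i => if (i <= n)%N then p i else P); split.
- by move=> i _; case: ifP => // /pp.
- move=> i; rewrite ltnS => le_in; rewrite le_in; case: ifP => [/ps //|/negbT].
  rewrite -ltnNge ltnS => ni; have -> : i = n by apply/eqP; rewrite eqn_leq le_in.
  by rewrite pQ.
- by rewrite ltnn.
Qed.

Lemma chain_to_sub n P Q : chain_to n P -> prime_ideal Q -> P `<=` Q -> chain_to n Q.
Proof.
case: n => [|n]; first by move=> _ pQ _; apply: chain_to0.
move/chain_toS=> [_ [P' cP' P'P]] pQ PQ; apply/chain_toS; split=> //.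
exists P' => //; case: P'P => P'P nP; split; first exact: subset_trans PQ.
by move=> QP'; apply/nP/(subset_trans PQ).
Qed.

Lemma prime_chainP n : prime_chain R n <-> exists P, chain_to n P.
Proof.
split=> [[p [pp ps]]|[P [p [pp ps _]]]]; last by exists p.
by exists (p n), p.
Qed.

Lemma prime_chain_leq n k : (n <= k)%N -> prime_chain R k -> prime_chain R n.
Proof.
move=> nk [p [pp ps]]; exists p; split=> i ni.
  by apply: pp; apply: leq_trans nk.
by apply: ps; apply: leq_trans nk.
Qed.

(** The products of a power of x and an element outside P form a multiplicative set, which misses I
    because x is regular modulo I. A prime over I avoiding this set lies in P and does not contain
    x. *)
Lemma prime_below_regular I P x : ideal I -> prime_ideal P -> I `<=` P -> P x ->
  (forall y, I (x * y) -> I y) -> exists Q, [/\ prime_ideal Q, I `<=` Q & Q `<` P].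
Proof.
move=> hI pP IP Px xreg.
have [_ P1 _] := pP.
pose S : set R := [set z | exists n s, ~ P s /\ z = x ^+ n * s].
have SI z : S z -> ~ I z.
  case=> n [s [Ps ->]]; elim: n => [|n IHn]; first by rewrite expr0 mul1r => /IP.
  by rewrite exprS -mulrA => /xreg.
have [||Q [pQ IQ SQ]] := prime_avoiding Rnoeth hI _ _ SI.
- by exists 0%N, 1; rewrite expr0 mul1r.
- move=> _ _ [n [s [Ps ->]]] [k [t [Pt ->]]]; exists (n + k)%N, (s * t).
  by rewrite exprD mulrACA; split=> //; apply: primeM.
exists Q; split=> //; split.
  move=> y Qy; apply: contrapT => Py; apply: (SQ y) => //.
  by exists 0%N, y; rewrite expr0 mul1r.
move/(_ x Px); apply: SQ; exists 1%N, 1; by rewrite expr1 mulr1.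
Qed.

Lemma regular_chain_to xs P : regular R^o xs -> prime_ideal P ->
  spanmod R^o xs `<=` P -> chain_to (size xs) P.
Proof.
elim: xs P => [|x xs IHxs] P /=; first by move=> _ pP _; apply: chain_to0.
move=> [rxs xreg] pP xsP; apply/chain_toS; split=> //.
have [||Q [pQ xsQ QP]] := prime_below_regular (ideal_span xs) pP _ _ xreg.
- by move=> y sy; apply: xsP; apply: (spanmod_cons (N := R^o)).
- rewrite -[x]mulr1; apply: xsP.
  by exists (1 : R^o), 0; rewrite addr0; split=> //; apply: (spanmod0 R^o).
by exists Q => //; apply: IHxs.
Qed.

End PrimeChains.

(** * Prime avoidance *)

Section PrimeAvoidance.
Variable A : comPzRingType.

Lemma prime_prod_avoid (T : eqType) (s : seq T) (p : T -> set A) (m P : set A) :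
  ideal m -> prime_ideal P -> ~ m `<=` P ->
  (forall t, t \in s -> ideal (p t) /\ ~ p t `<=` P) ->
  exists y, [/\ m y, ~ P y & forall t, t \in s -> p t y].
Proof.
move=> hm pP mP; elim: s => [|t s IHs] ps.
  by have /existsNP [y /not_implyP [my Py]] := mP; exists y.
have [|y [my Py sy]] := IHs.
  by move=> u us; apply: ps; rewrite in_cons us orbT.
have [hpt /existsNP [z /not_implyP [ptz Pz]]] := ps t (mem_head _ _).
exists (z * y); split.
- by case: hm => _ _; apply.
- exact: primeM.
- move=> u; rewrite in_cons => /orP [/eqP ->|us]; first exact: (ideal_mulr _ hpt ptz).
  have [|[_ _ puM] _] := ps u; first by rewrite in_cons us orbT.
  by apply/puM/sy.
Qed.

(** The alternative [m = set0] is the outcome for the empty list of primes; callers discard it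
    because an ideal contains 0. *)
Lemma prime_avoidance (T : eqType) (s : seq T) (p : T -> set A) (m : set A) :
  ideal m -> (forall t, t \in s -> prime_ideal (p t)) ->
  (forall x, m x -> exists2 t, t \in s & p t x) -> 
  m = set0 \/ exists2 t, t \in s & m `<=` p t.
Proof.
move=> hm; have [n] := ubnP (size s); elim: n s => // n IHn [|t s] /= sn ps ms.
  by left; rewrite predeqE => x; split=> // /ms [].
right; apply: contrapT => nt.
have {}nt u : u \in t :: s -> ~ m `<=` p u by move=> us mu; apply: nt; exists u.
have m0 : m <> set0 by move=> m0; have := nt t (mem_head _ _); rewrite m0; apply.
have pt := ps t (mem_head _ _).
have sub u : u \in s -> u \in t :: s by rewrite in_cons => ->; rewrite orbT.
have short s' : {subset s' <= t :: s} -> (size s' <= size s)%N ->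
    exists2 x, m x & forall u, u \in s' -> ~ p u x.
  move=> ss' sz; apply: contrapT => nx.
  have [|||[u us' mu]] := IHn s' (leq_ltn_trans sz sn).
  - by move=> u /ss' /ps.
  - move=> x mx; apply: contrapT => nu; apply: nx; exists x => // u us' pu.
    by apply: nu; exists u.
  - by [].
  - by apply: (nt u) => //; apply: ss'.
(* A prime contained in [p t] is redundant, and dropping it leaves a shorter covering list. *)
have [[u us put]|nu] := pselect (exists2 u, u \in s & p u `<=` p t).
  have [||x mx xs'] := short (t :: rem u s).
  - move=> v; rewrite !in_cons => /orP [->//|/mem_rem ->]; by rewrite orbT.
  - by rewrite /= size_rem //; case: (s) us => //.
  have [v] := ms x mx; rewrite in_cons => /orP [/eqP ->|vs].
    by apply: xs'; rewrite mem_head.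
  have [->|vu] := eqVneq v u.
    by move/put; apply: xs'; rewrite mem_head.
  apply: xs'; rewrite in_cons; apply/orP; right.
  have := vs; rewrite (perm_mem (perm_to_rem us)) in_cons (negbTE vu) /=.
  by [].
have [||x mx xs'] := short s => //.
have ptx : p t x.
  have [v] := ms x mx; rewrite in_cons => /orP [/eqP -> //|vs].
  by move/(xs' v vs).
have [|y [my pty sy]] := prime_prod_avoid (s := s) (p := p) hm pt (nt t (mem_head _ _)).
  move=> u us; split; first by case: (ps u (sub u us)).
  by move=> put; apply: nu; exists u.
(* x lies in [p t] and in no prime of s, y in all primes of s but not in [p t], so x + y lies in
   none of them. *)
have [v] := ms (x + y) (let: And3 _ mD _ := hm in mD x y mx my).
rewrite in_cons => /orP [/eqP ->|vs] vxy.
  case: pt => hpt _ _; apply: pty; rewrite addrC in vxy.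
  exact: idealDl vxy.
case: (ps v (sub v vs)) => hpv _ _.
by apply: (xs' v vs); apply: idealDl vxy => //; apply: sy.
Qed.

End PrimeAvoidance.

Section RegularElements.
Variables (A R : comPzRingType) (phi : {rmorphism A -> R}).
Hypothesis Rnoeth : noetherian R.
Implicit Types (I P T : set R).

Lemma prime_preimage P : prime_ideal P -> prime_ideal (phi @^-1` P).
Proof.
case=> -[P0 PD PM] P1 PP; split; first split; rewrite /preimage /=.
- by rewrite rmorph0.
- by move=> x y; rewrite rmorphD; apply: PD.
- by move=> a x; rewrite rmorphM; apply: PM.
- by rewrite rmorph1.
- by move=> x y; rewrite rmorphM; apply: PP.
Qed.

(** T is an arbitrary set: elements of T outside the current span are added to s until the ascending
    chain of spans stops. *)
Lemma noetherian_gens T : exists2 s : seq R,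
  (forall u, u \in s -> T u) & T `<=` spanmod R^o s.
Proof.
suff gens K : ideal K -> forall s, (forall u, u \in s -> T u) ->
    K = spanmod R^o s -> exists2 s' : seq R,
      (forall u, u \in s' -> T u) & T `<=` spanmod R^o s'.
  by apply: (gens _ (ideal_span [::]) [::]).
move: K; apply: (noeth_ind Rnoeth) => K hK IH s sT KE.
have [Ts|/existsNP [u /not_implyP [Tu su]]] := pselect (T `<=` spanmod R^o s).
  by exists s.
apply: (IH _ (ideal_span (u :: s)) _ (u :: s)) => //.
  rewrite KE; split; first exact: (spanmod_cons (N := R^o)).
  move=> ssub; apply/su/ssub.
  exists (1 : R^o), 0; rewrite addr0 /GRing.scale /= mulr1.
  by split=> //; apply: (spanmod0 R^o).
by move=> v; rewrite in_cons => /orP [/eqP ->|/sT].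
Qed.

(** The zero divisors modulo I are covered by finitely many maximal colon ideals; if no element of m
    is regular, prime avoidance for their preimages puts m inside one of these. Avoidance takes
    place in A so that the regular element comes from m. *)
Lemma regular_or_socle (m : set A) I : ideal m -> ideal I ->
  (exists2 x, m x & forall y, I (phi x * y) -> I y) \/
  (exists2 u, prime_ideal (colon I u) & forall x, m x -> I (phi x * u)).
Proof.
move=> hm hI; have [|nreg] := pselect (exists2 x, m x & forall y, I (phi x * y) -> I y).
  by left.
right; have [s sT Ts] := noetherian_gens (maxcolon I).
have [|||m0|[u us mu]] := @prime_avoidance A _ s (fun u => phi @^-1` colon I u) m.
- by [].
- by move=> u /sT /(maxcolon_prime hI) /prime_preimage.
- move=> x mx.
  have [y Ixy Iy] : exists2 y, I (phi x * y) & ~ I y.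
    apply: contrapT => ny; apply: nreg; exists x => // y Ixy.
    by apply: contrapT => Iy; apply: ny; exists y.
  have [u mu yu] := maxcolon_ex Rnoeth hI Iy.
  have pu := maxcolon_prime hI mu.
  (* Otherwise some z outside [colon I u] multiplies every v in s into I, hence also u, which lies
     in the span of s. *)
  have [v vs vu] : exists2 v, v \in s & colon I v `<=` colon I u.
    apply: contrapT => nv.
    have hT : ideal [set: R] by [].
    have [||z [_ uz zs]] := prime_prod_avoid (s := s) (p := colon I) hT pu.
    + by case: (pu) => _ u1 _ /(_ 1 Logic.I).
    + move=> v vs; split; first exact: colon_ideal.
      by move=> vu; apply: nv; exists v.
    apply: uz; rewrite /colon /= mulrC.
    have /= := @spanmod_sub _ R^o (colon I z) s (colon_ideal z hI) _ u (Ts u mu).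
    apply=> v w vs; have := zs v vs; rewrite /colon /= => Izv.
    by rewrite /GRing.scale /= mulrAC [v * z]mulrC; apply: ideal_mulr.
  exists v => //; have [_ mv] := sT v vs; apply: (mv u) => //.
    by case: mu.
  by apply: yu.
- by case: hm; rewrite m0.
- by exists u => //; apply: maxcolon_prime => //; apply: sT.
Qed.

End RegularElements.

(** * Krull's height theorem *)

Section Height.
Variable R : comPzRingType.
Hypothesis Rnoeth : noetherian R.
Implicit Types (I K M N P Q : set R).

Definition saturated P I : Prop := forall s r, ~ P s -> I (s * r) -> I r.

(** For P prime, the contraction to R of the extension of I to the localization at P. *)
Definition saturation P I : set R := [set r | exists2 s, ~ P s & I (s * r)].

Definition minimal_over I P : Prop :=
  forall Q, prime_ideal Q -> I `<=` Q -> Q `<=` P -> P `<=` Q.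

Lemma sub_saturation P I : prime_ideal P -> I `<=` saturation P I.
Proof. by case=> _ P1 _ r Ir; exists 1; rewrite ?mul1r. Qed.

Lemma saturation_ideal P I : prime_ideal P -> ideal I -> ideal (saturation P I).
Proof.
move=> pP hI; case: (hI) (pP) => I0 ID IM [_ P1 _]; split.
- by apply: sub_saturation.
- move=> x y [s Ps Isx] [t Pt Ity]; exists (s * t); first exact: primeM.
  rewrite mulrDr; apply: ID; last by rewrite -mulrA; apply: IM.
  by rewrite [s * t]mulrC -mulrA; apply: IM.
- by move=> a x [s Ps Isx]; exists s => //; rewrite mulrCA; apply: IM.
Qed.

Lemma saturation_saturated P I : prime_ideal P -> saturated P (saturation P I).
Proof.
move=> pP s r Ps [t Pt Itsr]; exists (t * s); first exact: primeM.
by rewrite -mulrA.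
Qed.

Lemma saturation_mono P I K : I `<=` K -> saturation P I `<=` saturation P K.
Proof. by move=> IK r [s Ps Isr]; exists s => //; apply: IK. Qed.

Lemma saturation_min P I K : saturated P K -> I `<=` K -> saturation P I `<=` K.
Proof. by move=> sK IK r [s Ps /IK]; apply: sK. Qed.

(** A prime over I avoiding all s y^n with s outside P would lie in P and miss y. Locally at P, the
    conclusion says that y is nilpotent modulo I. *)
Lemma minimal_over_radical P I y : prime_ideal P -> ideal I ->
  minimal_over I P -> P y -> exists s n, ~ P s /\ I (s * y ^+ n).
Proof.
move=> pP hI minP Py; apply: contrapT => nI.
have [_ P1 _] := pP.
pose S : set R := [set z | exists s n, ~ P s /\ z = s * y ^+ n].
have [|||Q [pQ IQ SQ]] := prime_avoiding (S := S) Rnoeth hI.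
- by exists 1, 0%N; rewrite expr0 mulr1.
- move=> _ _ [s [n [Ps ->]]] [t [k [Pt ->]]]; exists (s * t), (n + k)%N.
  by rewrite exprD mulrACA; split=> //; apply: primeM.
- by move=> _ [s [n [Ps ->]]] Is; apply: nI; exists s, n.
apply: (SQ y); first by exists 1, 1%N; rewrite expr1 mul1r.
apply: (minP Q) => // z Qz; apply: contrapT => Pz; apply: (SQ z) => //.
by exists z, 0%N; rewrite expr0 mulr1.
Qed.

(* The localization of R / I at P is Artinian; ideals of R saturated with respect
   to P stand for the ideals of the localization. *)
Lemma saturated_dcc P I (U : nat -> set R) : prime_ideal P ->
  ideal I -> saturated P I ->
  (forall y, P y -> exists s n, ~ P s /\ I (s * y ^+ n)) ->
  (forall k, ideal (U k)) -> (forall k, saturated P (U k)) ->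
  (forall k, I `<=` U k) -> (forall k, U k.+1 `<=` U k) ->
  exists k0, forall k, (k0 <= k)%N -> U k0 `<=` U k.
Proof.
move=> pP hI; move: U; move: I hI.
apply: (noeth_ind Rnoeth) => I hI IH U sI Irad hU sU IU US.
have Ule i j : (i <= j)%N -> U j `<=` U i.
  move=> /subnK <-; elim: (j - i)%N => [|k IHk]; first by rewrite add0n.
  by rewrite addSn; apply: subset_trans IHk.
have [I1|I1] := pselect (I 1).
  by exists 0%N => k _ x _; rewrite -[x]mulr1; apply: IU; case: hI => _ _; apply.
have [a ma _] := maxcolon_ex Rnoeth hI I1.
have pa := maxcolon_prime hI ma.
have [Ia _] := ma.
(* [colon I a] is prime and contains a power of each element of P, so P a lies in I: locally at P, a
   generates a simple submodule of R / I. *)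
have Pa x : P x -> I (x * a).
  move=> /Irad [s [n [Ps Isx]]]; apply: (primeX (n := n) pa).
  apply: (sI s) => //; rewrite mulrA; apply: ideal_mulr => //.
pose I' := saturation P (adjoin I a).
have hI' : ideal I' by apply: saturation_ideal => //; apply: adjoin_ideal.
have II' : I `<` I'.
  split; first by apply: (subset_trans (@sub_adjoin _ I a)); apply: sub_saturation.
  by move=> /(_ a); apply: contra_not Ia; apply; apply/sub_saturation/adjoin_mem.
pose U' k := saturation P (adjoin (U k) a).
have adj_mono I1' I2 : I1' `<=` I2 -> adjoin I1' a `<=` adjoin I2 a.
  by move=> I12 _ [i [c [/I12 Ii ->]]]; exists i, c.
have [||||||k0 k0P] := IH _ hI' II' U'.
- exact: saturation_saturated.
- move=> y /Irad [s [n [Ps Is]]]; exists s, n; split=> //.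
  by case: II' => II' _; apply: II'.
- by move=> k; apply: saturation_ideal => //; apply: adjoin_ideal.
- by move=> k; apply: saturation_saturated.
- by move=> k; apply/saturation_mono/adj_mono.
- by move=> k; apply/saturation_mono/adj_mono.
(* Modulo a the chain is stationary from k0 on. If every [U k] contains a, this is the chain itself;
   otherwise, beyond k1, s x = u + c a forces c into P, whence c a is in I and x in [U k]. *)
have [Ua|/existsNP [k1 Uk1]] := pselect (forall k, U k a).
  exists k0 => k k0k x Ux; have := k0P k k0k x.
  have -> : U' k = U k.
    rewrite eqEsubset; split.
      apply: saturation_min => // _ [i [c [Ui ->]]].
      by case: (hU k) => _ UD UM; apply: UD => //; apply: UM.
    by apply: subset_trans (sub_saturation pP); apply: sub_adjoin.
  by apply; apply/sub_saturation/sub_adjoin.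
exists (maxn k0 k1) => k kk x Ux.
have k0k : (k0 <= k)%N by apply: leq_trans kk; rewrite leq_maxl.
have k1x : U k1 x by apply: Ule Ux; rewrite leq_maxr.
have k0x : U k0 x by apply: Ule Ux; rewrite leq_maxl.
have [s Ps [u [c [Uu sx]]]] : U' k x.
  by apply: (k0P k) => //; apply/sub_saturation/sub_adjoin.
have uk1 : U k1 u by apply: Ule Uu; apply: leq_trans kk; rewrite leq_maxr.
have Pc : P c.
  apply: contrapT => Pc; apply: Uk1; apply: (sU k1 c) => //.
  apply: (idealDl (hU k1) uk1); rewrite addrC -sx.
  by case: (hU k1) => _ _; apply.
apply: (sU k s) => //; rewrite sx; case: (hU k) => _ UD _; apply: UD => //.
by apply/IU/Pa.
Qed.

(** Generators of M are eliminated one by one: substituting into the relation for g gives g the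
    coefficient t s - x c, which is outside P and thus a unit locally. *)
Lemma local_nakayama P x M N : prime_ideal P -> P x -> ideal M -> ideal N ->
  (forall r, M r -> exists s n w, [/\ ~ P s, N n, M w & s * r = n + x * w]) ->
  M `<=` saturation P N.
Proof.
move=> pP Px hM hN MN; have [N0 ND NM] := hN; have [hP P1 _] := pP.
have [gs gsM Mgs] := noetherian_fg Rnoeth hM.
have [gens] : (forall g, g \in gs -> M g) /\ forall r, M r -> exists s n h,
    [/\ ~ P s, N n, spanmod R^o gs h & s * r = n + h].
  split=> // r Mr; exists 1, 0, r; rewrite mul1r add0r; split=> //.
  apply: Mgs Mr; first exact: ideal_span.
  move=> g ggs; rewrite -[g]mulr1; exact: (mem_spanmod (N := R^o)).
elim: gs gens {gsM Mgs} => [|g gs IHgs] gsM spanM.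
  move=> r /spanM [s [n [h [Ps Nn -> sr]]]]; exists s => //.
  by rewrite sr addr0.
have Mg : M g by apply: gsM; rewrite mem_head.
apply: IHgs => [h hgs|r Mr]; first by apply: gsM; rewrite in_cons hgs orbT.
have [s [n [w [Ps Nn Mw sg]]]] := MN g Mg.
have [t [n' [h' [Pt Nn' [c [h [gsh h'E]]] tw]]]] := spanM w Mw.
have [t' [n2 [h2' [Pt' Nn2 [c2 [h2 [gsh2 h2E]]] tr]]]] := spanM r Mr.
have Pd : ~ P (t * s - x * c).
  have Pts := primeM pP Pt Ps.
  apply: contra_not Pts => Pd.
  have -> : t * s = (t * s - x * c) + x * c by rewrite subrK.
  by case: hP => _ PD _; apply: PD => //; apply: ideal_mulr; case: (pP).
have [_ gD gZ] := spanmod_submodule R^o gs.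
exists ((t * s - x * c) * t'), ((t * s - x * c) * n2 + c2 * (t * n + x * n')),
  ((t * s - x * c) * h2 + c2 * (x * h)); split.
- exact: primeM.
- by apply: (ND); [apply: NM | apply: (NM); apply: (ND); apply: (NM)].
- by apply: gD; [apply: gZ | apply: (gZ); apply: gZ].
have dg : (t * s - x * c) * g = t * n + x * n' + x * h.
  have -> : (t * s - x * c) * g = t * (s * g) - x * c * g by ring.
  have -> : t * (s * g) = t * n + x * (t * w) by rewrite sg; ring.
  by rewrite tw h'E /GRing.scale /=; ring.
rewrite -mulrA tr h2E /GRing.scale /=.
have -> : (t * s - x * c) * (n2 + (g * c2 + h2)) = 
  (t * s - x * c) * n2 + c2 * ((t * s - x * c) * g) + (t * s - x * c) * h2 by ring.
by rewrite dg; ring.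
Qed.

(** Krull's principal ideal theorem for the domain R / Q, phrased as the impossibility of a chain of
    length two. *)
Lemma principal_ideal_theorem Q P1 P x :
  prime_ideal Q -> prime_ideal P1 -> prime_ideal P -> Q `<` P1 -> P1 `<` P ->
  P x -> minimal_over (adjoin Q x) P -> False.
Proof.
move=> pQ pP1 pP [QP1 nP1Q] [P1P nPP1] Px minP.
have [hQ _ QM] := pQ; have [hP1 _ _] := pP1; have [_ QD _] := hQ.
have P1x : ~ P1 x.
  move=> P1x; apply: nPP1; apply: minP => // _ [q [c [Qq ->]]].
  by case: hP1 => _ P1D P1Z; apply: P1D; [apply: QP1 | apply: P1Z].
have /existsNP [y /not_implyP [P1y Qy]] := nP1Q.
(* Analogues of symbolic powers, formed from y at P1 modulo Q. After adding x and localizing at P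
   they become stationary, and Nakayama then removes x. *)
pose I k := saturation P1 (adjoin Q (y ^+ k)).
have hI k : ideal (I k) by apply: saturation_ideal => //; apply: adjoin_ideal.
have sI k : saturated P1 (I k) by apply: saturation_saturated.
have IS k : I k.+1 `<=` I k.
  apply: saturation_mono => _ [q [c [Qq ->]]]; exists q, (c * y).
  by rewrite exprS mulrA.
pose U k := saturation P (adjoin (I k) x).
have hU k : ideal (U k) by apply: saturation_ideal => //; apply: adjoin_ideal.
have QI k : Q `<=` I k.
  by move=> q Qq; apply/sub_saturation/sub_adjoin.
have adj_mono I1 I2 : I1 `<=` I2 -> adjoin I1 x `<=` adjoin I2 x.
  by move=> I12 _ [i [c [/I12 Ii ->]]]; exists i, c.
have hQx : ideal (saturation P (adjoin Q x)).
  by apply: saturation_ideal => //; apply: adjoin_ideal.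
have [|||||k0 /(_ k0.+1 (leqnSn _)) Uk0] := @saturated_dcc P _ U pP hQx
    (saturation_saturated pP).
- move=> z Pz.
  have [s [n [Ps Qxs]]] := minimal_over_radical pP (adjoin_ideal x hQ) minP Pz.
  by exists s, n; split=> //; apply: sub_saturation.
- exact: hU.
- by move=> k; apply: saturation_saturated.
- by move=> k; apply/saturation_mono/adj_mono.
- by move=> k; apply/saturation_mono/adj_mono.
have IP1 : I k0 `<=` I k0.+1.
  have := @local_nakayama P x _ _ pP Px (hI k0) (hI k0.+1).
  move=> nak r Ikr; have [|s Ps Isr] := nak _ r Ikr; last first.
    by apply: (sI k0.+1 s) => //; move/P1P.
  move=> r' Ir'.
  have [|s Ps [i [z [Ii sr]]]] := Uk0 r'; first exact/sub_saturation/sub_adjoin.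
  exists s, i, z; rewrite sr [z * x]mulrC; split=> //.
  (* x is not in P1 and [I k0] is saturated, so it suffices that x z lies in [I k0]. *)
  apply: (sI k0 x) => //.
  apply: (idealDl (hI k0) (IS _ _ Ii)); rewrite addrC mulrC -sr.
  by case: (hI k0) => _ _; apply.
have [|s P1s [q [c [Qq syk]]]] := IP1 (y ^+ k0).
  by apply/sub_saturation/adjoin_mem.
(* y is not in the prime Q, so s - c y is, and s falls into P1. *)
have : Q (y ^+ k0 * (s - c * y)).
  by rewrite mulrBr [_ * s]mulrC syk exprS; have -> :
    q + c * (y * y ^+ k0) - y ^+ k0 * (c * y) = q by ring.
case/QM => [/(primeX pQ) //|/QP1 P1scy]; apply: P1s.
have -> : s = (s - c * y) + c * y by rewrite subrK.
by case: hP1 => _ P1D P1Z; apply: P1D => //; apply: P1Z.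
Qed.

(** Induction on n through a prime P1 of height at least n, maximal strictly below P. Some x of xs
    is outside P1, so P is minimal over P1 + (x), and each y of xs satisfies s y^k = b + c x with b
    in P1. The elements b for the remaining y then have P1 as a minimal prime. *)
Lemma height_theorem n P (xs : seq R) : chain_to n P ->
  (forall x, x \in xs -> P x) ->
  (forall Q, prime_ideal Q -> (forall x, x \in xs -> Q x) -> Q `<=` P -> P `<=` Q) ->
  (n <= size xs)%N.
Proof.
elim: n P xs => // n IHn P xs /chain_toS [pP [Q cQ [QP nPQ]]] xsP minP.
have [P1 [cP1 P1P nPP1 P1max]] : exists P1, [/\ chain_to n P1, P1 `<=` P, ~ P `<=` P1 &
   forall P2, prime_ideal P2 -> P1 `<=` P2 -> P2 `<=` P -> ~ P `<=` P2 -> P2 `<=` P1].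
  have hQ : ideal Q by case: (chain_to_prime cQ).
  move: Q hQ cQ QP nPQ; apply: (noeth_ind Rnoeth) => Q hQ IH cQ QP nPQ.
  have [mQ|/existsNP [P2 /not_implyP [pP2 /not_implyP [QP2 /not_implyP [P2P
      /not_implyP [nPP2 nP2Q]]]]]] := pselect (forall P2, prime_ideal P2 -> Q `<=` P2 ->
     P2 `<=` P -> ~ P `<=` P2 -> P2 `<=` Q); first by exists Q.
  apply: (IH P2) => //; first by case: pP2.
  exact: chain_to_sub cQ pP2 QP2.
have pP1 := chain_to_prime cP1.
have [x xxs P1x] : exists2 x, x \in xs & ~ P1 x.
  apply: contrapT => nx; apply: nPP1; apply: minP => // x xxs.
  by apply: contrapT => P1x; apply: nx; exists x.
case: (pP1) => hP1 _ _; case: (hP1) => _ P1D P1M.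
have minP1x : minimal_over (adjoin P1 x) P.
  move=> P2 pP2 P12 P2P; apply: contrapT => nPP2; apply: P1x.
  apply: (P1max P2) => //; last exact/P12/adjoin_mem.
  by apply: subset_trans P12; apply: sub_adjoin.
have witness y : exists b, y \in xs -> P1 b /\ exists s k c, ~ P s /\ s * y ^+ k = b + c * x.
  have [yxs|nyxs] := boolP (y \in xs); last by exists 0.
  have [s [k [Ps [b [c [P1b sy]]]]]] :=
    minimal_over_radical pP (adjoin_ideal x hP1) minP1x (xsP y yxs).
  by exists b; split=> //; exists s, k, c.
have [b bP] := choice witness.
have [Q2|nQ2] := pselect (exists Q2, [/\ prime_ideal Q2,
    forall y, y \in rem x xs -> Q2 (b y), Q2 `<=` P1 & ~ P1 `<=` Q2]); last first.
  suff : (n <= size (map b (rem x xs)))%N.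
    by rewrite size_map size_rem //; case: (xs) xxs.
  apply: (IHn P1) => // [|Q2 pQ2 bQ2 Q2P1].
  - by move=> _ /mapP [y /mem_rem yxs ->]; case: (bP y yxs).
  - apply: contrapT => nP1Q2; apply: nQ2; exists Q2; split=> // y yxs.
    by apply/bQ2/map_f.
case: Q2 => Q2 [pQ2 bQ2 Q2P1 nP1Q2].
(* A prime Q2 strictly below P1 containing these b would make P minimal over Q2 + (x): a prime
   inside P over Q2 + (x) contains every y. *)
exfalso; apply: (principal_ideal_theorem pQ2 pP1 pP) => //; first exact: (xsP x).
move=> Q3 pQ3 Q23 Q3P; apply: minP => // y yxs.
have [hQ3 _ _] := pQ3; have [_ Q3D Q3M] := hQ3.
have Q3x : Q3 x by apply/Q23/adjoin_mem; case: pQ2.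
have [->//|yx] := eqVneq y x.
have Q3b : Q3 (b y).
  apply/Q23/sub_adjoin/bQ2.
  by move: yxs; rewrite (perm_mem (perm_to_rem xxs)) in_cons (negbTE yx).
have [_ [s [k [c [Ps syk]]]]] := bP y yxs.
have : Q3 (s * y ^+ k) by rewrite syk; apply: Q3D => //; apply: Q3M.
by case: (pQ3) => _ _ Q3prime /Q3prime [/Q3P //|/(primeX pQ3)].
Qed.

End Height.

(** * Injective modules and resolutions *)

Section QuotientModule.
Variables (A : comPzRingType) (M : lmodType A) (G : set M).

(** The proof that G is a submodule is an argument so that the structure of the quotient can be
    inferred from it. *)
Definition quot_pred of submodule G : {pred M} := fun x => x \in G.

Variable hG : submodule G.

Lemma quot_predP x : reflect (G x) (x \in quot_pred hG).
Proof.
apply: (iffP idP) => [|Gx]; first by rewrite unfold_in => /set_mem.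
by rewrite unfold_in; apply/mem_set.
Qed.

Fact quot_pred_zmod_closed : zmod_closed (quot_pred hG).
Proof.
split; first by apply/quot_predP; case: hG.
by move=> x y /quot_predP Gx /quot_predP Gy; apply/quot_predP; apply: (submoduleB hG).
Qed.

HB.instance Definition _ :=
  GRing.isZmodClosed.Build M (quot_pred hG) quot_pred_zmod_closed.

Definition quotmod := Quotient.quot (quot_pred hG : zmodClosed M).
HB.instance Definition _ := ZmodQuotient.on quotmod.

Definition qpi (x : M) : quotmod := (\pi_quotmod x)%qT.

Lemma qpi_eq x y : qpi x = qpi y <-> G (x - y).
Proof.
split=> [/eqP|Gxy].
  by rewrite /qpi -Quotient.idealrBE => /quot_predP.
by apply/eqP; rewrite /qpi -Quotient.idealrBE; apply/quot_predP.
Qed.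

Lemma qpiD x y : qpi (x + y) = qpi x + qpi y.
Proof. by rewrite /qpi pi_addr. Qed.

Lemma qpi_surj (q : quotmod) : exists x, q = qpi x.
Proof. by exists (repr q); rewrite /qpi reprK. Qed.

Definition quot_scale (a : A) (q : quotmod) : quotmod := qpi (a *: repr q).

Lemma qpiZ a x : quot_scale a (qpi x) = qpi (a *: x).
Proof.
apply/qpi_eq; rewrite -scalerBr; case: hG => _ _; apply.
by apply/qpi_eq; rewrite /qpi reprK.
Qed.

Fact quot_scaleA a b q : quot_scale a (quot_scale b q) = quot_scale (a * b) q.
Proof. by have [x ->] := qpi_surj q; rewrite !qpiZ scalerA. Qed.

Fact quot_scale1 : left_id 1 quot_scale.
Proof. by move=> q; have [x ->] := qpi_surj q; rewrite qpiZ scale1r. Qed.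

Fact quot_scaleDr : right_distributive quot_scale +%R.
Proof.
move=> a q r; have [x ->] := qpi_surj q; have [y ->] := qpi_surj r.
by rewrite -qpiD !qpiZ scalerDr qpiD.
Qed.

Fact quot_scaleDl q : {morph quot_scale^~ q : a b / a + b}.
Proof. by move=> a b; have [x ->] := qpi_surj q; rewrite !qpiZ scalerDl qpiD. Qed.

HB.instance Definition _ := GRing.Zmodule_isLmodule.Build A quotmod
  quot_scaleA quot_scale1 quot_scaleDr quot_scaleDl.

Fact qpi_linear : linear qpi.
Proof. by move=> a x y; rewrite qpiD -qpiZ. Qed.

HB.instance Definition _ := GRing.isLinear.Build A M quotmod *:%R qpi qpi_linear.

End QuotientModule.

Section LinearMaps.
Variable A : comPzRingType.
Implicit Types X Y N E : lmodType A.

Definition linear_of X Y (h : X -> Y) (hL : linear h) : {linear X -> Y} :=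
  HB.pack h (GRing.isLinear.Build A X Y *:%R h hL).

Lemma quotient_ex X (G : set X) : submodule G ->
  exists (Q : lmodType A) (p : {linear X -> Q}),
    (forall q, exists x, p x = q) /\ forall x, p x = 0 <-> G x.
Proof.
move=> hG; exists (quotmod hG), (@qpi A X G hG); split.
  by move=> q; have [x ->] := qpi_surj q; exists x.
by move=> x; rewrite -{2}[x]subr0 -(qpi_eq hG) linear0.
Qed.

Lemma inj0 X Y (h : {linear X -> Y}) :
  (forall x, h x = 0 -> x = 0) -> injective h.
Proof.
by move=> h0 x y hxy; apply/eqP; rewrite -subr_eq0; apply/eqP/h0; rewrite linearB /= hxy subrr.
Qed.

(** A map defined on a submodule of X is given by its graph G. As G (u, 0) forces u = 0, E embeds in
    the pushout (E x X) / G; a retraction r of this embedding yields the extension y |-> - r (0,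
    y). *)
Lemma injective_extension E X (G : set (E * X)) : injective_module E ->
  submodule G -> (forall u, G (u, 0) -> u = 0) ->
  exists h : {linear X -> E}, forall u y, G (u, y) -> h y = u.
Proof.
move=> hE hG G0; have [Q [p [_ pG]]] := quotient_ex hG.
have iL : linear (fun u : E => p (u, 0)).
  by move=> a u v; rewrite -linearP; congr (p _); congr (_, _); rewrite /= scaler0 add0r.
have iI : injective (linear_of iL) by apply: inj0 => u /pG /G0.
have [r rP] := hE E Q (linear_of iL) idfun iI.
have hL : linear (fun y : X => - r (p (0, y))).
  move=> a y z; rewrite scalerN -opprD -!linearP; congr (- r (p _)).
  by congr (_, _); rewrite /= scaler0 add0r.
exists (linear_of hL) => u y Guy /=.
have : r (p (u, y)) = 0 by rewrite (proj2 (pG _) Guy) linear0.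
have -> : (u, y) = (u, 0) + (0, y) by congr (_, _); rewrite /= ?add0r ?addr0.
rewrite !linearD /=; have /= -> := rP u.
by move/eqP; rewrite addr_eq0 => /eqP.
Qed.

End LinearMaps.

(** * Divisible groups and characters with values in Q/Z *)

Section DivisibleGroups.

Definition divisible (D : zmodType) : Prop :=
  forall n (u : D), (0 < n)%N -> exists v, v *+ n = u.

Definition subgroup (Y : zmodType) (K : set Y) : Prop :=
  K 0 /\ forall x y, K x -> K y -> K (x - y).

Section Subgroup.
Variables (Y : zmodType) (K : set Y).
Hypothesis hK : subgroup K.

Lemma subgroupN x : K x -> K (- x).
Proof. by case: hK => K0 KB Kx; rewrite -sub0r; apply: KB. Qed.

Lemma subgroupD x y : K x -> K y -> K (x + y).
Proof. by case: (hK) => _ KB Kx Ky; rewrite -[y]opprK; apply: KB => //; apply: subgroupN. Qed.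

Lemma subgroupMz x k : K x -> K (x *~ k).
Proof.
move=> Kx; have Kn n : K (x *+ n).
  elim: n => [|n IHn]; first by rewrite mulr0n; case: hK.
  by rewrite mulrS; apply: subgroupD.
by case: k => n; [rewrite -pmulrn | rewrite NegzE mulrNz -pmulrn; apply: subgroupN].
Qed.

End Subgroup.

(** Division with remainder; the two cases are infinite and finite order of y modulo K. *)
Lemma order_mod (Y : zmodType) (K : set Y) (y : Y) : subgroup K ->
  (forall k : int, K (y *~ k) -> k = 0) \/
  exists n, [/\ (0 < n)%N, K (y *+ n) & forall k : int, K (y *~ k) ->
    exists q, k = q * n%:Z].
Proof.
move=> hK; have [exn|nex] := pselect (exists n, (0 < n)%N && `[< K (y *+ n) >]).
  right; case: (ex_minnP exn) => n /andP [n0 /asboolP Kn] nmin.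
  exists n; split=> // k Kk; exists (k %/ n%:Z)%Z.
  have nz0 : n%:Z != 0 by rewrite eqz_nat -lt0n.
  have := divz_eq k n%:Z.
  have := modz_ge0 k nz0; have := ltz_pmod k (n0 : 0 < n%:Z).
  have Kr : K (y *~ (k %% n)%Z).
    have -> : (k %% n)%Z = k - (k %/ n)%Z * n by rewrite {2}(divz_eq k n) addrC addKr.
    rewrite mulrzBr mulrC mulrzA; case: (hK) => _; apply => //.
    by apply: (subgroupMz hK); rewrite -pmulrn.
  case: (k %% n)%Z Kr => // r; rewrite -pmulrn => Kr rn _ kE.
  have [r0|r0] := posnP r; first by rewrite r0 addr0 in kE.
  have : (n <= r)%N by apply: nmin; rewrite r0; apply/asboolP.
  by rewrite leqNgt; move: rn; rewrite ltz_nat => ->.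
left=> k Kk; apply: contrapT => k0; apply: nex.
case: k Kk k0 => n.
  rewrite -pmulrn => Kn; case: n Kn => // n Kn _; exists n.+1.
  by apply/andP; split=> //; apply/asboolP.
rewrite NegzE mulrNz -pmulrn => /(subgroupN hK); rewrite opprK => Kn _.
by exists n.+1; apply/andP; split=> //; apply/asboolP.
Qed.

(** Baer's argument: a maximal single-valued subgroup containing the graph G is defined everywhere,
    since divisibility allows it to be enlarged by any y outside its domain. *)
Lemma divisible_extension (D Y : zmodType) (G : set (D * Y)) : divisible D ->
  subgroup G -> (forall u, G (u, 0) -> u = 0) ->
  exists h : Y -> D, (forall x y, h (x - y) = h x - h y) /\
    forall u y, G (u, y) -> h y = u.
Proof.
move=> divD hG G0.
pose ok (K : set (D * Y)) := subgroup K /\ forall u, K (u, 0) -> u = 0.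
(* The union with G is tested, instead of K itself, because Zorn's lemma includes the empty chain,
   whose union is empty. *)
have [|K0 [okK maxK]] := @Zorn_bigcup _ [set K | ok (G `|` K)].
  move=> F Fok Ftot /=.
  have stage x y : (G `|` \bigcup_(X in F) X) x -> (G `|` \bigcup_(X in F) X) y ->
      exists K, [/\ ok K, K x, K y & K `<=` G `|` \bigcup_(X in F) X].
    have okG : ok G by [].
    have inF X : F X -> ok (G `|` X) /\ G `|` X `<=` G `|` \bigcup_(X in F) X.
      by move=> FX; split; [apply: Fok | apply: setUS; apply: bigcup_sup].
    case=> [Gx|[X FX Xx]] [Gy|[Z FZ Zy]].
    - by exists G; split.
    - by have [? ?] := inF Z FZ; exists (G `|` Z); split=> //; [left|right].
    - by have [? ?] := inF X FX; exists (G `|` X); split=> //; [right|left].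
    - have [XZ|ZX] := Ftot X Z FX FZ.
        by have [? ?] := inF Z FZ; exists (G `|` Z); split=> //; right => //; apply: XZ.
      by have [? ?] := inF X FX; exists (G `|` X); split=> //; right => //; apply: ZX.
  split; first split.
  - by left; case: hG.
  - move=> x y Fx Fy; have [K [[[_ KB] _] Kx Ky sK]] := stage x y Fx Fy.
    by apply/sK/KB.
  - by move=> u Fu; have [K [[_ K0] Ku _ _]] := stage _ _ Fu Fu; apply: K0.
pose K := G `|` K0; have {okK} [hK Kfun] : ok K by [].
have functional u v y : K (u, y) -> K (v, y) -> u = v.
  move=> Ku Kv; apply/eqP; rewrite -subr_eq0; apply/eqP/Kfun.
  have -> : (u - v, 0) = (u, y) - (v, y) by congr (_, _); rewrite /= subrr.
  by case: hK => _; apply.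
have KM u y k : K (u, y) -> K (u *~ k, y *~ k).
  move/(subgroupMz hK k); congr K.
  by rewrite [LHS]surjective_pairing (raddfMz fst) (raddfMz snd).
have total y : exists u, K (u, y).
  apply: contrapT => nKy.
  pose dom : set Y := [set z | exists u, K (u, z)].
  have hdom : subgroup dom.
    split; first by exists 0; case: hK.
    move=> a b [u Ka] [v Kb]; exists (u - v).
    by have := (proj2 hK) _ _ Ka Kb.
  (* The value u for y: 0 if no nonzero multiple of y lies in the domain, otherwise an n-th part of
     the value w at y *+ n. *)
  have [u uP] : exists u, forall v k, K (v, y *~ k) -> v = u *~ k.
    have [free|[n [n0 [w Kw] gen]]] := order_mod y hdom.
      exists 0 => v k Kv; have k0 : k = 0 by apply: free; exists v.
      by rewrite k0 !mulr0z in Kv *; apply: Kfun.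
    have [u uw] := divD n w n0; exists u => v k Kv.
    have [|q kE] := gen k; first by exists v.
    have := KM _ _ q Kw; rewrite {1}pmulrn -mulrzA mulrC -kE => Kq.
    by rewrite (functional _ _ _ Kv Kq) -uw pmulrn -mulrzA mulrC -kE.
  pose K' : set (D * Y) := [set z | exists a k, K a /\ z = a + (u *~ k, y *~ k)].
  have KK' : K `<=` K'.
    by move=> a Ka; exists a, 0; split=> //; rewrite !mulr0z addr0.
  apply: (maxK K').
    split; first by apply: subset_trans KK'; right.
    move/(_ (u, y)) => K0u; apply: nKy; exists u; right; apply: K0u.
    by exists 0, 1; rewrite !mulr1z add0r; split=> //; case: hK.
  have GK' : G `<=` K' by apply: subset_trans KK'; left.
  rewrite /= (_ : G `|` K' = K'); last exact/setUidPr.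
  split; first split.
  - by apply: KK'; case: hK.
  - move=> _ _ [a [k [Ka ->]]] [b [l [Kb ->]]]; exists (a - b), (k - l).
    split; first by case: hK => _; apply.
    by rewrite opprD addrACA; congr (_ + _); congr (_, _); rewrite mulrzBr.
  - move=> v [[a z] [k [Ka [-> zE]]]].
    have KN : K (- a, y *~ k).
      have := subgroupN hK Ka; congr K; congr (_, _).
      by apply/eqP; rewrite eqr_oppLR -addr_eq0; apply/eqP.
    by rewrite -(uP _ _ KN) subrr.
have [h hP] := choice total; exists h; split.
  move=> x y; apply: (functional _ _ (x - y)) => //.
  have := (proj2 hK) _ _ (hP x) (hP y).
  by [].
by move=> u y Gu; apply: functional (hP y) _; left.
Qed.

Definition int_pred : {pred rat} := fun x => x \is a Num.int.
Fact int_pred_zmod_closed : zmod_closed int_pred.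
Proof. by split=> [|x y]; rewrite !unfold_in; [exact: rpred0 | exact: rpredB]. Qed.
HB.instance Definition _ := GRing.isZmodClosed.Build rat int_pred int_pred_zmod_closed.

Definition QZ := Quotient.quot (int_pred : zmodClosed rat).
HB.instance Definition _ := ZmodQuotient.on QZ.

Definition qz (x : rat) : QZ := (\pi_QZ x)%qT.

Lemma qz_eq0 x : qz x = 0 <-> x \is a Num.int.
Proof.
have -> : (0 : QZ) = qz 0 by rewrite /qz; symmetry; exact: pi_zeror.
have -> : (x \is a Num.int) = (x - 0 \in int_pred) by rewrite subr0.
by rewrite Quotient.idealrBE; split=> /eqP.
Qed.

Lemma qzMn x n : qz (x *+ n) = qz x *+ n.
Proof.
elim: n => [|n IHn]; first by rewrite !mulr0n /qz pi_zeror.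
by rewrite !mulrS -IHn /qz pi_addr.
Qed.

Lemma QZ_divisible : divisible QZ.
Proof.
move=> n u n0; exists (qz (repr u / n%:R)).
rewrite -qzMn -[_ *+ n]mulr_natr divfK ?reprK //; first by rewrite /qz reprK.
by rewrite Num.Theory.pnatr_eq0 -lt0n.
Qed.

Lemma QZ_cogenerator (N : zmodType) (x : N) : x <> 0 ->
  exists c : N -> QZ, (forall y z, c (y - z) = c y - c z) /\ c x <> 0.
Proof.
move=> x0.
(* u is the class of 1/n with n the order of x; for infinite order any nonzero element works, here
   the class of 1/2. *)
have [u u0 uP] : exists2 u : QZ, u <> 0 & forall k, x *~ k = 0 -> u *~ k = 0.
  have hK : subgroup [set (0 : N)] by split=> // _ _ -> ->; rewrite subr0.
  have qzV n : (1 < n)%N -> qz (n%:R^-1) <> 0 /\ qz (n%:R^-1) *+ n = 0.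
    move=> n1; have n0 : n%:R != 0 :> rat by rewrite Num.Theory.pnatr_eq0 -lt0n ltnW.
    split; last by rewrite -qzMn -[_ *+ n]mulr_natr mulVf //; apply/qz_eq0.
    move/qz_eq0/Num.Theory.intrP => [k kE].
    have : n%:~R * k%:~R = 1%:~R :> rat by rewrite -kE -pmulrn mulfV.
    rewrite -intrM => /eqP; rewrite eqr_int => /eqP nk.
    have /eqP := congr1 absz nk; rewrite abszM muln_eq1 => /andP [/eqP nE _].
    by rewrite /= in nE; rewrite nE in n1.
  have [free|[n [n0 xn gen]]] := order_mod x hK.
    exists (qz (2%:R^-1)); first by have [] := qzV 2%N isT.
    by move=> k /free ->.
  have n1 : (1 < n)%N by case: n n0 xn {gen} => // -[].
  have [u0 un] := qzV n n1; exists (qz (n%:R^-1)) => // k /gen [q ->].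
  by rewrite mulrC mulrzA -pmulrn un mul0rz.
pose G : set (QZ * N) := [set z | exists k, z = (u *~ k, x *~ k)].
have [||h [hB hG]] := @divisible_extension _ _ G QZ_divisible.
- split; first by exists 0; rewrite !mulr0z.
  by move=> _ _ [k ->] [l ->]; exists (k - l); rewrite !mulrzBr.
- by move=> v [k [-> /esym /uP]].
exists h; split=> //; rewrite (hG u) //; by exists 1; rewrite !mulr1z.
Qed.

End DivisibleGroups.

(* The product over all characters c : N -> Q/Z of the A-modules Hom_Z(A, Q/Z). *)
Section CharacterHull.
Variables (A : comPzRingType) (N : lmodType A).

Definition chars := {c : N -> QZ | forall y z, c (y - z) = c y - c z}.

Definition hull_set : set (chars * A -> QZ) :=
  [set g | forall c a b, g (c, a - b) = g (c, a) - g (c, b)].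

Definition hull_pred : {pred chars * A -> QZ} := fun g => g \in hull_set.

Lemma hull_predP g : reflect (hull_set g) (g \in hull_pred).
Proof.
apply: (iffP idP) => [|hg]; first by rewrite unfold_in => /set_mem.
by rewrite unfold_in; apply/mem_set.
Qed.

Fact hull_zmod_closed : zmod_closed hull_pred.
Proof.
split; first by apply/hull_predP => c a b; rewrite subr0.
move=> g h /hull_predP hg /hull_predP hh; apply/hull_predP => c a b.
have e z : (g - h) z = g z - h z by [].
by rewrite !e hg hh !opprD !opprK addrACA.
Qed.

Definition hull := {g : chars * A -> QZ | g \in hull_pred}.
HB.instance Definition _ := SubChoice.on hull.
HB.instance Definition _ :=
  GRing.SubChoice_isSubZmodule.Build (chars * A -> QZ) hull_pred hull hull_zmod_closed.

Definition mk_hull g (hg : g \in hull_pred) : hull :=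
  exist (fun g => g \in hull_pred) g hg.

Fact hull_scale_subproof (a : A) (g : hull) :
  (fun z : chars * A => val g (z.1, z.2 * a)) \in hull_pred.
Proof. by apply/hull_predP => c b d /=; rewrite mulrBl; have /hull_predP := valP g; apply. Qed.

Definition hull_scale a g : hull := mk_hull (hull_scale_subproof a g).

Lemma hull_ext (g h : hull) : (forall c a, val g (c, a) = val h (c, a)) -> g = h.
Proof. by move=> gh; apply/val_inj/funext => -[c a]. Qed.

Lemma hullD (g h : hull) z : val (g + h) z = val g z + val h z.
Proof. by rewrite raddfD. Qed.

Lemma hullB (g h : hull) z : val (g - h) z = val g z - val h z.
Proof. by rewrite raddfB. Qed.

Lemma hull0 z : val (0 : hull) z = 0.
Proof. by rewrite raddf0. Qed.

Lemma hull_scaleE a g c b : val (hull_scale a g) (c, b) = val g (c, b * a).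
Proof. by []. Qed.

Lemma hull_additive (g : hull) c a b : val g (c, a + b) = val g (c, a) + val g (c, b).
Proof.
have /hull_predP hg := valP g.
by have := hg c (a + b) b; rewrite addrK => ->; rewrite subrK.
Qed.

Fact hull_scaleA a b g : hull_scale a (hull_scale b g) = hull_scale (a * b) g.
Proof. by apply: hull_ext => c d; rewrite !hull_scaleE mulrA. Qed.

Fact hull_scale1 : left_id 1 hull_scale.
Proof. by move=> g; apply: hull_ext => c d; rewrite hull_scaleE mulr1. Qed.

Fact hull_scaleDr : right_distributive hull_scale +%R.
Proof. by move=> a g h; apply: hull_ext => c d; rewrite hullD !hull_scaleE hullD. Qed.

Fact hull_scaleDl g : {morph hull_scale^~ g : a b / a + b}.
Proof.
by move=> a b; apply: hull_ext => c d; rewrite hullD !hull_scaleE mulrDr hull_additive.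
Qed.

HB.instance Definition _ := GRing.Zmodule_isLmodule.Build A hull
  hull_scaleA hull_scale1 hull_scaleDr hull_scaleDl.

Lemma hullZ a (g : hull) c b : val (a *: g) (c, b) = val g (c, b * a).
Proof. exact: hull_scaleE. Qed.

Fact hull_aug_subproof (x : N) :
  (fun z : chars * A => sval z.1 (z.2 *: x)) \in hull_pred.
Proof.
by apply/hull_predP => -[c hc] a b /=; rewrite scalerBl hc.
Qed.

Definition hull_aug x : hull := mk_hull (hull_aug_subproof x).

Lemma hull_augE x c b : val (hull_aug x) (c, b) = sval c (b *: x).
Proof. by []. Qed.

Lemma char_add (Y : zmodType) (c : Y -> QZ) : (forall y z, c (y - z) = c y - c z) ->
  forall y z, c (y + z) = c y + c z.
Proof. by move=> hc y z; have := hc (y + z) z; rewrite addrK => ->; rewrite subrK. Qed.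

Fact hull_aug_linear : linear hull_aug.
Proof.
move=> a x y; apply: hull_ext => c b.
rewrite hullD hullZ !hull_augE scalerDr scalerA.
by apply: char_add; case: c.
Qed.

Lemma hull_aug_inj x : hull_aug x = 0 -> x = 0.
Proof.
move=> x0; apply: contrapT => /QZ_cogenerator [c [hc cx]]; apply: cx.
have := congr1 (fun g : hull => val g (exist _ c hc, 1)) x0.
by rewrite hull_augE scale1r hull0.
Qed.

(** A linear map g into Hom_Z(A, Q/Z) is determined by the additive map x |-> g x 1 to Q/Z. For each
    c this additive map is extended by divisibility to some h, and y |-> (b |-> h (b y)) is the
    linear extension. *)
Lemma hull_injective : injective_module hull.
Proof.
move=> X Y i g inji.
pose ext (c : chars) (h : Y -> QZ) :=
  (forall y z, h (y - z) = h y - h z) /\ forall x, h (i x) = val (g x) (c, 1).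
have ext_ex c : exists h, ext c h.
  pose G : set (QZ * Y) := [set z | exists x, z = (val (g x) (c, 1), i x)].
  have [||h [hB hG]] := @divisible_extension _ _ G QZ_divisible.
  - split; first by exists 0; rewrite !linear0 hull0.
    by move=> _ _ [x ->] [y ->]; exists (x - y); rewrite !linearB hullB.
  - move=> u [x [-> ix]]; have -> : x = 0 by apply: inji; rewrite linear0.
    by rewrite linear0 hull0.
  by exists h; split=> // x; apply: hG; exists x.
have [h hP] := choice ext_ex.
have hull_h y : (fun z : chars * A => h z.1 (z.2 *: y)) \in hull_pred.
  by apply/hull_predP => c a b /=; rewrite scalerBl; case: (hP c).
pose k y : hull := mk_hull (hull_h y).
have kE y c b : val (k y) (c, b) = h c (b *: y) by [].
have kL : linear k.
  move=> a y z; apply: hull_ext => c b.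
  rewrite hullD hullZ !kE scalerDr scalerA.
  by apply: char_add; case: (hP c).
exists (linear_of kL) => x; apply: hull_ext => c b.
by rewrite kE -linearZ; case: (hP c) => _ ->; rewrite linearZ hullZ mul1r.
Qed.

End CharacterHull.

Section Resolutions.
Variable A : comPzRingType.
Implicit Types N : lmodType A.

(** The cokernel of N -> [hull N] is packed with its projection so that one choice fixes both and
    can be iterated. *)
Record cosyzygy_data N := CosyzygyData {
  cosyz_obj : lmodType A;
  cosyz_proj : {linear hull N -> cosyz_obj};
  cosyz_proj_surj : forall q, exists x, cosyz_proj x = q;
  cosyz_proj_ker : forall x, cosyz_proj x = 0 <-> exists y : N, hull_aug y = x }.

Lemma cosyzygy_ex N : exists C : cosyzygy_data N, True.
Proof.
pose aug : {linear N -> hull N} := linear_of (@hull_aug_linear A N).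
have [|C [p [ps pk]]] := @quotient_ex A (hull N) [set x | exists y, aug y = x].
  split.
  - by exists 0; rewrite linear0.
  - by move=> _ _ [x <-] [y <-]; exists (x + y); rewrite linearD.
  - by move=> a _ [x <-]; exists (a *: x); rewrite linearZ.
by exists (CosyzygyData ps pk).
Qed.

Definition cosyz N : cosyzygy_data N := projT1 (cid (cosyzygy_ex N)).
Definition cosyzygy N : lmodType A := cosyz_obj (cosyz N).

Lemma injective_resolution_ex N : inhabited (injective_resolution N).
Proof.
pose C i := iter i cosyzygy N.
(* The differential projects the hull of the i-th cosyzygy onto the next cosyzygy and embeds that in
   its own hull. *)
have dL i : linear (fun x : hull (C i) => hull_aug (cosyz_proj (cosyz (C i)) x) : hull (C i.+1)).
  by move=> a x y; rewrite linearP hull_aug_linear.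
constructor.
refine (@InjectiveResolution A N (fun i => hull (C i)) (linear_of (@hull_aug_linear A N))
  (fun i => linear_of (dL i)) _ _ _ _).
- by move=> i; apply: hull_injective.
- by apply: inj0 => x; apply: hull_aug_inj.
- move=> x /=; rewrite -cosyz_proj_ker; split; first exact: hull_aug_inj.
  by move=> ->; exact: (linear0 (linear_of (@hull_aug_linear A _))).
- move=> i x /=; split.
    move/hull_aug_inj/cosyz_proj_ker => [y <-]; have [z <-] := cosyz_proj_surj y.
    by exists z.
  move=> [y <-]; have /cosyz_proj_ker -> : exists z, hull_aug z = hull_aug (cosyz_proj (cosyz (C i)) y).
    by exists (cosyz_proj (cosyz (C i)) y).
  exact: (linear0 (linear_of (@hull_aug_linear A _))).
Qed.

End Resolutions.

(** * Local cohomology and regular sequences *)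

Section Subfunctors.
Variable A : comPzRingType.

(** A subfunctor of the identity. With F = [ann I] the complex F(E) is Hom(A / I, E); with F =
    [torsion m] it computes local cohomology. *)
Definition subfunctor (F : forall M : lmodType A, set M) : Prop :=
  (forall M, submodule (F M)) /\
  (forall (X Y : lmodType A) (h : {linear X -> Y}) x, F X x -> F Y (h x)).

Definition ann (I : set A) (M : lmodType A) : set M :=
  [set x | forall a, I a -> a *: x = 0].

Arguments ann I M _ : clear implicits.

Lemma ann_subfunctor I : subfunctor (ann I).
Proof.
split=> [M|X Y h x hx a Ia]; last by rewrite -linearZ hx ?linear0.
split.
- by move=> a _; rewrite scaler0.
- by move=> x y hx hy a Ia; rewrite scalerDr hx ?hy ?addr0.
- by move=> b x hx a Ia; rewrite scalerA mulrC -scalerA hx ?scaler0.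
Qed.

Lemma ideal_exp_anti (m : set A) n k : (n <= k)%N -> ideal_exp m k `<=` ideal_exp m n.
Proof.
have S i : ideal_exp m i.+1 `<=` ideal_exp m i.
  elim: i => // i IHi x [s [sm xE]]; exists s; split=> // u us.
  by have [mu1 iu2] := sm u us; split=> //; apply: IHi.
move=> /subnK <-; elim: (k - n)%N => [|i IHi]; first by rewrite add0n.
by rewrite addSn; apply: subset_trans IHi.
Qed.

Lemma torsion_subfunctor m : subfunctor (torsion (A := A) m).
Proof.
split=> [M|X Y h x [n hx]]; last first.
  by exists n => a ma; rewrite -linearZ hx ?linear0.
split.
- by exists 0%N => a _; rewrite scaler0.
- move=> x y [n hx] [k hy]; exists (maxn n k) => a ma.
  rewrite scalerDr hx ?hy ?addr0 //.
    by apply: ideal_exp_anti ma; rewrite leq_maxr.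
  by apply: ideal_exp_anti ma; rewrite leq_maxl.
- by move=> b x [n hx]; exists n => a ma; rewrite scalerA mulrC -scalerA hx ?scaler0.
Qed.

End Subfunctors.

Arguments ann {A} I M _.

Section Vanishing.
Variables (A : comPzRingType) (N : lmodType A) (E : injective_resolution N).
Implicit Types (F : forall M : lmodType A, set M) (I m : set A).

Local Notation d i := (res_diff E i).

Definition boundary F i : set (res_obj E i) :=
  match i with
  | 0 => [set 0]
  | j.+1 => [set d j y | y in F (res_obj E j)]
  end.

Definition exact_at F i : Prop :=
  forall z, F (res_obj E i) z -> d i z = 0 -> boundary F z.

Lemma res_dd i x : d i.+1 (d i x) = 0.
Proof. by apply/res_exactS; exists x. Qed.

Lemma boundary_cycle F i z : boundary F (i := i) z -> d i z = 0.
Proof.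
by case: i z => [z ->|i z [y _ <-]]; [rewrite linear0 | rewrite res_dd].
Qed.

Lemma boundary_sub F i z : subfunctor F -> boundary F (i := i) z -> F _ z.
Proof.
case: i z => [z [sF _] ->|i z [_ sF] [y Fy <-]]; first by case: (sF (res_obj E 0)).
exact: sF.
Qed.

Lemma boundary_mono F F' i : (forall M, F M `<=` F' M) ->
  boundary F (i := i) `<=` boundary F' (i := i).
Proof. by move=> FF'; case: i => // i z [y /FF' Fy <-]; exists y. Qed.

Lemma boundary0 F i : subfunctor F -> boundary F (0 : res_obj E i).
Proof.
by case: i => // i [sF _]; exists 0; [case: (sF (res_obj E i)) | rewrite linear0].
Qed.

(* A complex of injectives which is exact in low degrees contracts there; as
   the contraction is linear, it also acts on any smaller subfunctor. *)
Lemma contraction F t : subfunctor F -> (forall i, (i < t)%N -> exact_at F i) ->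
  forall i, (i < t)%N -> exists s : {linear res_obj E i.+1 -> res_obj E i},
    forall e, F _ e -> d i (s (d i e)) = d i e.
Proof.
move=> [sF nF] exF.
(* As p kills the cycles of F, the assignment d e |-> p e is well defined for e in F; injectivity
   extends it to s, and d p = d gives d s d = d on F. *)
have extend i (p : res_obj E i -> res_obj E i) : linear p ->
    (forall e, d i (p e) = d i e) -> (forall e, F _ e -> d i e = 0 -> p e = 0) ->
    exists s : {linear res_obj E i.+1 -> res_obj E i},
      forall e, F _ e -> d i (s (d i e)) = d i e.
  move=> pL dp p0.
  pose G : set (res_obj E i * res_obj E i.+1) :=
    [set z | exists e, F _ e /\ z = (p e, d i e)].
  have pL0 : p 0 = 0 := linear0 (linear_of pL).
  have pLD x y : p (x + y) = p x + p y := linearD (linear_of pL) x y.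
  have pLZ a x : p (a *: x) = a *: p x := linearZ_LR (linear_of pL) a x.
  have [||h hG] := @injective_extension A _ _ G (@res_injective _ _ E i).
  - have [F0 FD FZ] := sF (res_obj E i); split.
    + by exists 0; rewrite linear0 pL0.
    + move=> _ _ [x [Fx ->]] [y [Fy ->]]; exists (x + y).
      by rewrite linearD pLD; split=> //; apply: FD.
    + move=> a _ [x [Fx ->]]; exists (a *: x).
      by rewrite linearZ pLZ; split=> //; apply: FZ.
  - by move=> u [e [Fe [-> /esym]]]; apply: p0.
  by exists h => e Fe; rewrite (hG (p e)) //; exists e.
elim=> [|i IHi] lt_it.
  apply: (extend 0%N id) => // e Fe /(exF 0%N lt_it e Fe); exact.
have [s sP] := IHi (ltnW lt_it).
(* Cycles of F in degree i+1 are boundaries d y with y in F, so subtracting d (s e) kills them. *)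
apply: (extend i.+1 (fun e => e - d i (s e))).
- move=> a x y; rewrite linearP /= linearP /= scalerBr opprD.
  by rewrite addrACA.
- by move=> e; rewrite linearB /= res_dd subr0.
- by move=> e Fe /(exF i.+1 lt_it e Fe) [y Fy <-]; rewrite sP ?subrr.
Qed.

(** A cycle z of F' is d y with y in F, so z = d (s z) for the contraction s, and s z is in F'
    because s is linear. *)
Lemma exact_subfunctor F F' t : subfunctor F -> subfunctor F' ->
  (forall M, F' M `<=` F M) -> (forall i, (i < t)%N -> exact_at F i) ->
  forall i, (i < t)%N -> exact_at F' i.
Proof.
move=> sF [_ nF'] FF' exF [|i] lt_it z F'z dz; have := exF _ lt_it z (FF' _ _ F'z) dz.
  by [].
have [s sP] := contraction sF exF (ltnW lt_it).
by move=> [y Fy yz]; exists (s z); [apply: nF' | rewrite -yz sP].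
Qed.

(** For a cycle z of F', the multiples of z by I are boundaries of F, so I kills z - d (s z), and
    exactness for [ann I] applies to this difference. *)
Lemma exact_extension F I F' t : subfunctor F -> subfunctor F' ->
  (forall M, ann I M `<=` F' M) -> (forall M a x, I a -> F' M x -> F M (a *: x)) ->
  (forall i, (i < t)%N -> exact_at F i) -> 
  forall i, (i < t)%N -> exact_at (ann I) i -> exact_at F' i.
Proof.
move=> sF [sF' nF'] IF' FI exF i lt_it exI z F'z dz.
have Iz a : I a -> boundary F (a *: z).
  by move=> Ia; apply: exF => //; [apply: FI | rewrite linearZ /= dz scaler0].
case: i z lt_it exI F'z dz Iz => [|i] z lt_it exI F'z dz Iz.
  by apply: exI.
have [s sP] := contraction sF exF (ltnW lt_it).
have [||e Ie ze] := exI (z - d i (s z)).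
- move=> a Ia; have [y Fy yz] := Iz a Ia.
  by rewrite scalerBr -!linearZ -yz sP ?subrr.
- by rewrite linearB /= dz res_dd subrr.
exists (s z + e).
  by have [_ F'D _] := sF' (res_obj E i); apply: F'D; [apply: nF' | apply: IF'].
by rewrite linearD /= ze addrC subrK.
Qed.

(** Climb through the powers of m, of whose annihilators the torsion is the union. *)
Lemma exact_ann_torsion m t : (forall i, (i < t)%N -> exact_at (ann m) i) ->
  forall i, (i < t)%N -> exact_at (@torsion A m) i.
Proof.
move=> exm.
have exp n : forall i, (i < t)%N -> exact_at (ann (ideal_exp m n)) i.
  elim: n => [|n IHn] i lt_it.
    move=> z Fz _; rewrite -[z]scale1r Fz //; exact: boundary0 (ann_subfunctor _).
  apply: (exact_extension (ann_subfunctor _) (ann_subfunctor _) _ _ IHn lt_it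
    (exm i lt_it)).
    move=> M x mx _ [s [sm ->]]; rewrite scaler_suml big_seq big1 // => u /sm [mu _].
    by rewrite mulrC -scalerA mx ?scaler0.
  move=> M a x ma Fx b mb; rewrite scalerA mulrC Fx //.
  exists [:: (a, b)]; split; last by rewrite big_seq1.
  by move=> u; rewrite inE => /eqP ->.
move=> i lt_it z [n nz] dz; have := exp n i lt_it z nz dz.
by apply: boundary_mono => M x nx; exists n.
Qed.

Lemma exact_torsion_ann m t : (forall i, (i < t)%N -> exact_at (@torsion A m) i) ->
  forall i, (i < t)%N -> exact_at (ann m) i.
Proof.
apply: exact_subfunctor; [exact: torsion_subfunctor | exact: ann_subfunctor |].
move=> M x mx; exists 1%N => _ [s [sm ->]].
rewrite scaler_suml big_seq big1 // => u /sm [mu _].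
by rewrite mulrC -scalerA mx ?scaler0.
Qed.

End Vanishing.

Arguments boundary {A N} E F i _.
Arguments exact_at {A N} E F i.

(** * The complex Hom(A / xs A, E) for a regular sequence xs *)

Section RegularOnResolution.
Variables (A : comPzRingType) (N : lmodType A) (E : injective_resolution N).
Implicit Types (xs : seq A).

Local Notation d i := (res_diff E i).
Local Notation annl xs := (ann [set a | a \in xs]).

Lemma annl_cons x xs (M : lmodType A) e :
  annl (x :: xs) M e <-> x *: e = 0 /\ annl xs M e.
Proof.
split=> [xe|[xe xse] a]; last by rewrite /= in_cons => /orP [/eqP ->//|/xse].
split=> [|a axs]; first by apply: xe; rewrite /= mem_head.
by apply: xe; rewrite /= in_cons; apply/orP; right.
Qed.

Lemma ann_spanmod xs (M : lmodType A) e a :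
  annl xs M e -> spanmod A^o xs a -> a *: e = 0.
Proof.
move=> xe; elim: xs a xe => [|x xs IHxs] a; first by move=> _ ->; rewrite scale0r.
move=> /annl_cons [xe xse] [u [v [sv ->]]].
have -> : x *: u = (u : A) * x by apply: mulrC.
by rewrite scalerDl (IHxs v) // addr0 -scalerA xe scaler0.
Qed.

(** Elements killed by xs are maps A / xs A -> M. Multiplication by x is injective on A / xs A, so
    the map given by e extends along it; w is the value of the extension at 1. *)
Lemma ann_divisible xs x (M : lmodType A) e : injective_module M ->
  (forall a, spanmod A^o xs (x * a) -> spanmod A^o xs a) -> annl xs M e ->
  exists2 w, annl xs M w & x *: w = e.
Proof.
move=> injM xreg xe.
pose G : set (M * A^o) :=
  [set z | exists i a, spanmod A^o xs i /\ z = (a *: e, i + x * a : A^o)].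
have [||h hG] := @injective_extension A _ _ G injM.
- split.
  + by exists 0, 0; rewrite scale0r mulr0 addr0; split=> //; apply: spanmod0.
  + move=> _ _ [i [a [si ->]]] [j [b [sj ->]]]; exists (i + j), (a + b).
    split; first exact: spanmodD.
    by congr (_, _); rewrite /= ?scalerDl // mulrDr addrACA.
  + move=> c _ [i [a [si ->]]]; exists (c * i), (c * a).
    split; first exact: spanmodZ.
    by congr (_, _); rewrite /= ?scalerA // /GRing.scale /= mulrDr mulrCA.
- move=> u [i [a [si [-> /esym ia]]]]; apply: (ann_spanmod xe); apply: xreg.
  have ia0 : (i : A) + x * a = 0 by exact: ia.
  have -> : x * a = - (i : A) by rewrite -[LHS](addKr (i : A)) ia0 addr0.
  by apply: (@submoduleN A A^o) => //; apply: spanmod_submodule.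
have scale1 (b : A) : h b = b *: h 1.
  by rewrite -linearZ /GRing.scale /= mulr1.
exists (h 1).
  move=> a axs; rewrite -scale1; apply: hG; exists a, 0.
  rewrite scale0r mulr0 addr0; split=> //; rewrite -[a]mulr1.
  exact: (mem_spanmod (N := A^o)).
rewrite -scale1; apply: hG; exists 0, 1.
by rewrite scale1r mulr1 add0r; split=> //; apply: spanmod0.
Qed.

(* The iterated connecting homomorphism, as a relation: it represents the
   isomorphism N / xs N -> H^k(Hom(A / xs A, E)) with k the length of xs. *)
Fixpoint connecting xs : N -> set (res_obj E (size xs)) :=
  match xs with
  | [::] => fun y z => z = res_aug E y
  | x :: xs' => fun y z => exists zk e,
      [/\ connecting y zk, annl xs' _ e, x *: e = zk & z = d _ e]
  end.

Arguments connecting xs y _ : clear implicits.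

Lemma connecting_cycle xs y z :
  connecting xs y z -> annl xs _ z /\ d _ z = 0.
Proof.
elim: xs y z => [|x xs IHxs] y z /=.
  by move=> ->; split=> //; apply/res_exact0; exists y.
move=> [zk [e [yzk xse xe ->]]]; have [_ dzk] := IHxs _ _ yzk.
split; last exact: res_dd.
have [_ nF] := ann_subfunctor [set a | a \in xs].
by apply/annl_cons; split; [rewrite -linearZ xe | apply: nF].
Qed.

Lemma connecting_linear xs a y y' z z' : connecting xs y z -> connecting xs y' z' ->
  connecting xs (a *: y + y') (a *: z + z').
Proof.
elim: xs y y' z z' => [|x xs IHxs] y y' z z' /=; first by move=> -> ->; rewrite linearP.
move=> [zk [e [yzk xse xe ->]]] [zk' [e' [yzk' xse' xe' ->]]].
exists (a *: zk + zk'), (a *: e + e'); split; first exact: IHxs.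
- have [sF _] := ann_subfunctor [set a | a \in xs].
  by have [_ FD FZ] := sF (res_obj E (size xs)); apply: FD => //; apply: FZ.
- by rewrite scalerDr xe' scalerA mulrC -scalerA xe.
- by rewrite linearP.
Qed.

Lemma connecting_scale xs a y z :
  connecting xs y z -> connecting xs (a *: y) (a *: z).
Proof.
move=> yz; have c0 : connecting xs 0 0.
  by have := connecting_linear (-1) yz yz; rewrite !scaleN1r !addNr.
by have := connecting_linear a yz c0; rewrite !addr0.
Qed.

Lemma boundary_divisible xs x i b :
  (forall a, spanmod A^o xs (x * a) -> spanmod A^o xs a) ->
  boundary E (annl xs) i b -> exists2 b', boundary E (annl xs) i b' & x *: b' = b.
Proof.
move=> xreg; case: i b => [b ->|i b [e xse <-]]; first by exists 0; rewrite ?scaler0.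
have [w xsw xw] := ann_divisible (@res_injective _ _ E i) xreg xse.
by exists (d _ w); [exists w | rewrite -linearZ xw].
Qed.

(** Multiplication by x is onto on Hom(A / xs A, E), with kernel the complex for x :: xs. The
    induction step is the long exact sequence of this extension, carried out on elements; x acts
    injectively on N / xs N, so only its cokernel survives, one degree higher. *)
Lemma regular_resolution xs : regular A^o xs -> regular N xs ->
  [/\ forall i, i <> size xs -> exact_at E (annl xs) i,
      forall y, exists z, connecting xs y z,
      forall z, annl xs _ z -> d _ z = 0 -> exists y, connecting xs y z &
      forall y z, connecting xs y z ->
        (boundary E (annl xs) _ z <-> spanmod N xs y)].
Proof.
elim: xs => [|x xs IHxs] /=.
  move=> _ _; split.
  - move=> [|i] // _ z _ /res_exactS [y <-]; exists y => //.
  - by move=> y; exists (res_aug E y).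
  - by move=> z _ /res_exact0 [y <-]; exists y.
  - move=> y z ->; split=> [y0|->]; last by rewrite linear0.
    by apply: (@res_aug_inj _ _ E); rewrite linear0.
move=> [regA xregA] [regN xregN]; have [ex tot surj bd] := IHxs regA regN.
set F := annl xs in ex surj bd *; set F' := annl (x :: xs).
have sF : subfunctor F by apply: ann_subfunctor.
have FB M u v : F M u -> F M v -> F M (u - v).
  by case: sF => sF _; apply: (submoduleB (sF M)).
have conn0 y z zk : connecting xs y zk -> connecting xs z zk -> spanmod N xs (y - z).
  move=> yzk zzk; have := connecting_linear (-1) zzk yzk.
  rewrite !scaleN1r addNr addrC => /bd [+ _]; apply.
  exact: boundary0.
have bdiv i b : boundary E F i b -> exists2 b', boundary E F i b' & x *: b' = b.
  exact: boundary_divisible.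
split.
- move=> i ik z /annl_cons [xz Fz] dz.
  have bz : boundary E F i z.
    have [ei|] := pselect (i = size xs); last by move/ex; apply.
    rewrite ei in z xz Fz dz *.
    have [y yz] := surj z Fz dz; apply/(bd _ _ yz)/xregN.
    by rewrite -[x *: y]subr0 -[0](scale0r y); apply: conn0 (connecting_scale _ yz) _; 
       rewrite xz -(scale0r z); apply: connecting_scale.
  case: i ik z xz Fz dz bz => [//|j] jk z xz Fz dz [e Fe ez].
  have jk' : j <> size xs by move=> jk'; apply: jk; rewrite jk'.
  (* x e is a cycle in a degree without cohomology, hence equal to x b for a boundary b; then e - b
     is killed by x and still maps to z. *)
  have [|b bb xb] := bdiv j (x *: e).
    apply: ex => //; first by case: sF => sF _; case: (sF (res_obj E j)) => _ _; apply.
    by rewrite linearZ /= ez.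
  exists (e - b); last by rewrite linearB /= (boundary_cycle bb) subr0.
  apply/annl_cons; split; first by rewrite scalerBr xb subrr.
  by apply: FB => //; apply: boundary_sub bb.
- move=> y; have [zk yzk] := tot y; have [Fzk _] := connecting_cycle yzk.
  have [e Fe xe] := ann_divisible (@res_injective _ _ E _) xregA Fzk.
  by exists (d _ e), zk, e; split.
- move=> z /annl_cons [xz Fz] dz.
  have [|e Fe ez] := ex (size xs).+1 _ z Fz dz; first by move/eqP; rewrite eqn_leq ltnn.
  have [||y yxe] := surj (x *: e).
  + by case: sF => sF _; case: (sF (res_obj E (size xs))) => _ _; apply.
  + by rewrite linearZ /= ez.
  by exists y, (x *: e), e; split.
move=> y _ [zk [e [yzk Fe xe ->]]]; split.
  move=> [e' /annl_cons [xe' Fe'] dee'].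
  have [||y' y'z] := surj (e - e'); first exact: FB.
    by rewrite linearB /= dee' subrr.
  exists y', (y - x *: y'); split; last by rewrite addrC subrK.
  apply: conn0 yzk _; rewrite -xe -[x *: e]subr0 -xe' -scalerBr.
  exact: connecting_scale.
move=> [u [v [sv yE]]]; rewrite yE in yzk; have [z' uz'] := tot u.
have [Fz' dz'] := connecting_cycle uz'.
(* v lies in xs N, so its representative is a boundary x b. Thus x e = x (z' + b), where z' + b is a
   cycle. *)
have vz : connecting xs v (zk - x *: z').
  have := connecting_linear (- x) uz' yzk.
  by rewrite !scaleNr addKr addrC.
have [_ /(_ sv) /bdiv [b bb xb]] := bd _ _ vz.
exists (e - (z' + b)); last first.
  by rewrite linearB linearD /= dz' (boundary_cycle bb) addr0 subr0.
apply/annl_cons; split.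
  by rewrite scalerBr scalerDr xb xe [_ + (zk - _)]addrC subrK subrr.
apply: FB => //; case: (sF) => sF' _; case: (sF' (res_obj E (size xs))) => _ FD _.
by apply: FD => //; apply: boundary_sub bb.
Qed.

Lemma regular_exact_lt xs (m : set A) : regular A^o xs -> regular N xs ->
  (forall x, x \in xs -> m x) ->
  forall i, (i < size xs)%N -> exact_at E (@torsion A m) i.
Proof.
move=> regA regN xsm; have [ex _ _ _] := regular_resolution regA regN.
apply: exact_ann_torsion; apply: (exact_subfunctor (ann_subfunctor _) (ann_subfunctor _)).
  by move=> M x mx a /xsm; apply: mx.
by move=> i lt_i; apply: ex => ei; rewrite ei ltnn in lt_i.
Qed.

(* Vanishing of Ext^k(A / m, N), which is Hom(A / m, N / xs N). *)
Lemma no_socle xs (m : set A) y : regular A^o xs -> regular N xs ->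
  (forall x, x \in xs -> m x) ->
  (forall i, (i <= size xs)%N -> exact_at E (@torsion A m) i) ->
  (forall a, m a -> spanmod N xs (a *: y)) -> spanmod N xs y.
Proof.
move=> regA regN xsm exm my.
have [ex tot surj bd] := regular_resolution regA regN.
have [z yz] := tot y; have [xsz dz] := connecting_cycle yz.
apply/(bd _ _ yz).
have exm' : exact_at E (ann m) (size xs).
  by apply: (@exact_torsion_ann _ _ _ _ (size xs).+1).
have sF := ann_subfunctor [set a | a \in xs].
have mz a : m a -> boundary E (annl xs) _ (a *: z).
  by move=> /my may; apply/(bd _ _ (connecting_scale a yz)).
have annm M : ann m M `<=` annl xs M by move=> e me a /xsm; apply: me.
have {}ex i : (i < size xs)%N -> exact_at E (annl xs) i.
  by move=> lt_i; apply: ex => ei; rewrite ei ltnn in lt_i.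
clear yz bd surj tot; case: (size xs) z ex exm' xsz dz mz => [|k] z ex exm' xsz dz mz.
  by apply: exm'.
have [s sP] := contraction sF ex (ltnSn k).
have [||e me ze] := exm' (z - d k (s z)).
- move=> a ma; have [u Fu uz] := mz a ma.
  by rewrite scalerBr -!linearZ -uz sP ?subrr.
- by rewrite linearB /= dz res_dd subrr.
exists (s z + e); last by rewrite linearD /= ze addrC subrK.
have [sF1 nF] := sF; have [_ FD _] := sF1 (res_obj E k).
by apply: FD; [apply: nF | apply: annm].
Qed.

(* A / xs A has projective dimension at most the length of xs, so that
   Ext^i(A / xs A, N) = 0 for larger i. *)
Lemma regular_exact_all xs (m : set A) n t : regular A^o xs -> regular N xs ->
  (forall x, x \in xs -> m x) -> (forall a, ideal_exp m n a -> spanmod A^o xs a) ->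
  (forall i, (i <= size xs)%N -> exact_at E (@torsion A m) i) ->
  forall i, (i < t)%N -> exact_at E (@torsion A m) i.
Proof.
move=> regA regN xsm mn exm; have [ex _ _ _] := regular_resolution regA regN.
(* This is the one degree in which Hom(A / xs A, E) could have cohomology; a power of m lies in xs
   A, so [annl xs] is contained in the torsion. *)
have exk : exact_at E (annl xs) (size xs).
  apply: (@exact_subfunctor _ _ E _ _ (size xs).+1 (torsion_subfunctor m)
    (ann_subfunctor _) _ _ _ (ltnSn _)).
    by move=> M e xse; exists n => a /mn; apply: ann_spanmod.
  by move=> i; rewrite ltnS; apply: exm.
apply: exact_ann_torsion; apply: (exact_subfunctor (ann_subfunctor _) (ann_subfunctor _)).
  by move=> M e me a /xsm; apply: me.
move=> i _; have [->|] := pselect (i = size xs); first exact: exk.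
by apply: ex.
Qed.

End RegularOnResolution.

(** * Maximal ideals and primary powers *)

Section Maximal.
Variable R : comPzRingType.
Implicit Types I m P : set R.

Lemma maximal_ex I : ideal I -> ~ I 1 -> exists2 m, maximal_ideal m & I `<=` m.
Proof.
move=> hI I1; pose ok (K : set R) := ideal K /\ ~ K 1.
(* Taking the union with I makes the empty chain admissible. *)
have [|K0 [okK maxK]] := @Zorn_bigcup _ [set K | ok (I `|` K)].
  move=> F Fok Ftot /=.
  have inF X : F X -> ok (I `|` X) /\ I `|` X `<=` I `|` \bigcup_(X in F) X.
    by move=> FX; split; [apply: Fok | apply: setUS; apply: bigcup_sup].
  have stage x y : (I `|` \bigcup_(X in F) X) x -> (I `|` \bigcup_(X in F) X) y ->
      exists K, [/\ ok K, K x, K y & K `<=` I `|` \bigcup_(X in F) X].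
    case=> [Ix|[X FX Xx]] [Iy|[Z FZ Zy]].
    - by exists I; split.
    - by have [? ?] := inF Z FZ; exists (I `|` Z); split=> //; [left|right].
    - by have [? ?] := inF X FX; exists (I `|` X); split=> //; [right|left].
    - have [XZ|ZX] := Ftot X Z FX FZ.
        by have [? ?] := inF Z FZ; exists (I `|` Z); split=> //; right => //; apply: XZ.
      by have [? ?] := inF X FX; exists (I `|` X); split=> //; right => //; apply: ZX.
  split; first split.
  - by left; case: hI.
  - move=> x y Fx Fy; have [K [[[_ KD _] _] Kx Ky sK]] := stage x y Fx Fy.
    by apply: sK; apply: KD.
  - move=> a x Fx; have [K [[[_ _ KM] _] Kx _ sK]] := stage x x Fx Fx.
    by apply: sK; apply: KM.
  - by move=> F1; have [K [[_ K1] /K1]] := stage _ _ F1 F1.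
have [hK K1] : ok (I `|` K0) by [].
exists (I `|` K0) => //; split=> // K hK' K1' sK; rewrite eqEsubset; split=> //.
have K0K : K0 `<=` K by apply: subset_trans sK.
apply: contrapT => nK; apply: (maxK K).
  by split=> // KK0; apply: nK; apply: subset_trans KK0 _.
by rewrite /= (_ : I `|` K = K) //; apply/setUidPr; apply: subset_trans sK.
Qed.

Lemma maximal_prime m : maximal_ideal m -> prime_ideal m.
Proof.
move=> [hm m1 mmax]; split=> // a b mab; apply: contrapT => /not_orP [ma mb].
have inv c : ~ m c -> adjoin m c 1.
  move=> mc; apply: contrapT => c1; apply: mc.
  rewrite -(mmax _ (adjoin_ideal c hm) c1 (@sub_adjoin _ m c)).
  exact: adjoin_mem.
have [i [c [mi ca]]] := inv a ma; have [j [e [mj eb]]] := inv b mb.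
apply: m1; rewrite -[1]mulr1 {1}ca eb; case: (hm) => _ mD mM.
have -> : (i + c * a) * (j + e * b) = (j + e * b) * i + ((c * a) * j + (c * e) * (a * b)) by ring.
by apply: (mD); [apply: (mM) | apply: (mD); apply: (mM)].
Qed.

Lemma local_prime_sub m P : local_ring m -> prime_ideal P -> P `<=` m.
Proof. by move=> [_ mu] [hP P1 _]; have [n /mu -> ] := maximal_ex hP P1. Qed.

(** Noetherian induction: some a outside I has a prime colon ideal, which contains m. If m^n lies in
    I + (a), then m^(n+1) lies in I since m a does. *)
Lemma power_sub_of_primes m I : noetherian R -> ideal I ->
  (forall P, prime_ideal P -> I `<=` P -> m `<=` P) ->
  exists n, ideal_exp m n `<=` I.
Proof.
move=> Rnoeth hI; move: I hI; apply: (noeth_ind Rnoeth) => I hI IH mI.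
have [I1|I1] := pselect (I 1).
  by exists 0%N => x _; rewrite -[x]mulr1; case: hI => _ _; apply.
have [a ma _] := maxcolon_ex Rnoeth hI I1; have [Ia _] := ma.
have [|n mn] := IH _ (adjoin_ideal a hI) (proper_adjoin hI Ia).
  move=> P pP aP; apply: mI => //; apply: subset_trans aP.
  exact: sub_adjoin.
exists n.+1 => _ [s [sm ->]]; case: (hI) => I0 ID IM; rewrite big_seq.
elim/big_ind: _ => // u us; have [mu /mn [i [c [Ii ->]]]] := sm u us.
rewrite mulrDr; apply: ID; first exact: IM.
rewrite mulrCA; apply: IM; apply: (mI _ (maxcolon_prime hI ma)) => // x Ix.
exact: ideal_mulr.
Qed.

End Maximal.

(** * Lower bounds for depth and dimension *)

Section DepthDimension.

Definition depth_ge (A : comPzRingType) (m : set A) (N : lmodType A) t : Prop :=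
  forall (E : injective_resolution N) i, (i < t)%N -> exact_at E (@torsion A m) i.

Lemma depth_ge_leq A m N t k : (k <= t)%N -> @depth_ge A m N t -> depth_ge m N k.
Proof. by move=> kt dN E i ik; apply: dN; apply: leq_trans kt. Qed.

Lemma local_cohomology_eq0P (A : comPzRingType) (m : set A) (N : lmodType A) i :
  ~ local_cohomology_neq0 m N i <->
  forall E : injective_resolution N, exact_at E (@torsion A m) i.
Proof.
have bdE (E : injective_resolution N) :
    boundary E (@torsion A m) i = coboundaries m (E := E) (i := i) by case: i.
split=> [nE E z tz dz|ex [E]].
  apply: contrapT => nz; apply: nE; exists E => /(_ z (conj tz dz)).
  by rewrite -bdE.
by apply=> z [tz dz]; rewrite -bdE; apply: ex.
Qed.

Lemma depth_geP (A : comPzRingType) (m : set A) (N : lmodType A) t :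
  depth_ge m N t <-> forall i, (i < t)%N -> ~ local_cohomology_neq0 m N i.
Proof.
split=> [dN i it|dN E i it]; first by apply/local_cohomology_eq0P => E; apply: dN.
by move: E; apply/local_cohomology_eq0P/dN.
Qed.

Lemma inf_natP (P : set nat) :
  (exists n, [/\ P n, forall k, P k -> (n <= k)%N & inf_nat P = n%:E%E]) \/
  (forall n, ~ P n) /\ inf_nat P = +oo%E.
Proof.
rewrite /inf_nat; case: pselect => [exP|nexP].
  left; case: (ex_minnP exP) => n /asboolP Pn nmin; exists n; split=> // k Pk.
  by apply: nmin; apply/asboolP.
by right; split=> // n Pn; apply: nexP; exists n; apply/asboolP.
Qed.

Lemma sup_natP (P : set nat) : P 0%N ->
  (exists n, [/\ P n, forall k, P k -> (k <= n)%N & sup_nat P = n%:E%E]) \/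
  (forall n, exists2 k, (n < k)%N & P k) /\ sup_nat P = +oo%E.
Proof.
move=> P0; rewrite /sup_nat; case: pselect => [exP|nexP]; last by case: nexP; exists 0%N.
have [[n [nub nmin ->]]|[nub ->]] := inf_natP [set b | forall n, P n -> (n <= b)%N].
  left; exists n; split=> //; apply: contrapT => Pn.
  case: n nub nmin Pn => // n nub nmin Pn.
  suff : (n.+1 <= n)%N by rewrite ltnn.
  apply: nmin => k Pk; have := nub k Pk; rewrite leq_eqVlt => /orP [/eqP kn|//].
  by rewrite kn in Pk.
right; split=> // n; apply: contrapT => nk; apply: (nub n) => k Pk.
by rewrite leqNgt; apply/negP => nk'; apply: nk; exists k.
Qed.

Lemma depth_finite (A : comPzRingType) (m : set A) (N : lmodType A) :
  depth m N <> +oo%E -> exists t, ~ depth_ge m N t.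
Proof.
move=> dN; apply: contrapT => ndN; apply: dN.
have [[n [Pn _ _]]|[_ //]] := inf_natP [set i | local_cohomology_neq0 m N i].
exfalso; apply: ndN; exists n.+1 => /depth_geP /(_ n (ltnSn n)); exact.
Qed.

(** Both values are suprema of downward closed sets of naturals, so comparing these sets covers
    infinite values too; the chain of length 0 keeps the dimension from being -oo. *)
Lemma depth_eq_dim (A R : comPzRingType) (m : set A) (N : lmodType A) :
  prime_chain R 0 ->
  depth m N = krull_dim R <-> forall t, prime_chain R t <-> depth_ge m N t.
Proof.
move=> c0; rewrite /depth /krull_dim.
have [[n [nub nmax ->]]|[nub ->]] := sup_natP c0; last first.
  have chain t : prime_chain R t.
    by have [k tk] := nub t; apply: prime_chain_leq; apply: ltnW.
  have [[k [Pk kmin ->]]|[nP ->]] := inf_natP [set i | local_cohomology_neq0 m N i].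
    split=> // /(_ k.+1) [/(_ (chain _)) /depth_geP /(_ k (ltnSn k)) []].
    exact: Pk.
  by split=> // _ t; split=> // _; apply/depth_geP => i _; apply: nP.
have chain t : prime_chain R t <-> (t <= n)%N.
  by split=> [/nmax //|tn]; apply: prime_chain_leq nub.
have [[k [Pk kmin ->]]|[nP ->]] := inf_natP [set i | local_cohomology_neq0 m N i].
  have dk t : depth_ge m N t <-> (t <= k)%N.
    split=> [/depth_geP dt|tk].
      by rewrite leqNgt; apply/negP => /dt; apply.
    apply/depth_geP => i it /kmin; rewrite leqNgt => /negP; apply.
    exact: leq_trans tk.
  split=> [[kn] t|ceq]; first by rewrite chain dk kn.
  congr (_%:E)%E; apply/eqP; rewrite eqn_leq; apply/andP; split.
    by apply/chain/ceq/dk.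
  by apply/dk/ceq/chain.
split=> // /(_ n.+1) [_ dn].
by have /dn/chain : depth_ge m N n.+1 by [apply/depth_geP => i _; apply: nP]; rewrite ltnn.
Qed.

Lemma prime_chain0 (R : comPzRingType) (P : set R) : prime_ideal P -> prime_chain R 0.
Proof. by move=> /chain_to0 cP; apply/prime_chainP; exists P. Qed.

Lemma last_true (C : nat -> Prop) t : C 0%N -> ~ C t ->
  exists d, [/\ (d < t)%N, C d & ~ C d.+1].
Proof.
move=> C0; elim: t => // t IHt Ct.
have [Ct'|/IHt [d [dt Cd Cd']]] := pselect (C t); first by exists t.
by exists d; split=> //; apply: ltnW.
Qed.

End DepthDimension.

(** * Regular sequences in m from depth over R *)

Section RegularFromDepth.
Variables (A R : comPzRingType) (phi : {rmorphism A -> R}) (m : set A) (n : set R).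
Hypotheses (Rnoeth : noetherian R) (hm : ideal m).
Hypothesis mn : forall x, m x -> n (phi x).
Hypothesis nprime : forall P, prime_ideal P -> (forall x, m x -> P (phi x)) -> n `<=` P.

(** If no element of m extends xs, then some u outside xs R has a prime colon ideal over m R. It
    contains n, so u is a socle element modulo xs R, against the depth. *)
Lemma regular_of_depth t : depth_ge n R^o t -> exists xs, [/\ size xs = t,
  forall x, x \in xs -> m x & regular R^o (map phi xs)].
Proof.
have [E] := injective_resolution_ex (R^o : lmodType R).
elim: t => [|t IHt] dt; first by exists [::].
have [|xs [sz xsm reg]] := IHt; first exact: depth_ge_leq dt.
have [[x mx xreg]|[u pu mu]] := regular_or_socle phi Rnoeth hm (ideal_span (map phi xs)).
  exists (x :: xs); split=> //=; first by rewrite sz.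
  by move=> y; rewrite in_cons => /orP [/eqP ->|/xsm].
have [_ u1 _] := pu; case: u1; rewrite /colon /= mul1r.
apply: (@no_socle _ _ E _ n) => //.
- by move=> _ /mapP [x xxs ->]; apply/mn/xsm.
- by move=> i; rewrite size_map sz => it; apply: dt.
- by move=> a /(nprime pu mu).
Qed.

End RegularFromDepth.

(** * The amalgamation *)

Section SplitExtension.
Variables (A R : comPzRingType) (phi : {rmorphism A -> R}) (p : {rmorphism R -> A}).
Variables (M : lmodType A) (q : R -> M) (m : set A).
Hypothesis p_phi : forall a, p (phi a) = a.
Hypothesis qD : forall r s, q (r + s) = q r + q s.
Hypothesis qZ : forall a r, q (phi a * r) = a *: q r.
Hypothesis pq_inj : forall r s, p r = p s -> q r = q s -> r = s.
Hypothesis pq_surj : forall a y, exists r, p r = a /\ q r = y.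
Hypotheses (Anoeth : noetherian A) (Rnoeth : noetherian R) (Alocal : local_ring m).

Let n := p @^-1` m.

Hypothesis nprime : forall P, prime_ideal P -> (forall x, m x -> P (phi x)) -> n `<=` P.

Implicit Types (xs : seq A).

Let m_maximal : maximal_ideal m. Proof. by case: Alocal. Qed.
Let m_prime : prime_ideal m. Proof. exact: maximal_prime. Qed.
Let m_ideal : ideal m. Proof. by case: m_maximal. Qed.

Lemma split_maximal : maximal_ideal n.
Proof.
have [_ m1 mmax] := m_maximal; have [hn _ _] := prime_preimage p m_prime.
split=> //; first by rewrite /n /preimage /= rmorph1.
move=> I hI I1 nI; rewrite eqEsubset; split=> // r Ir.
have [I0 ID IM] := hI.
have p_lift a r' : p r' = a -> exists2 s, r' = phi a + s & p s = 0.
  by move=> pr; exists (r' - phi a); rewrite ?rmorphB /= ?p_phi ?pr ?subrr // addrC subrK.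
have pI : [set p r | r in I] = m.
  apply: mmax.
  - split.
    + by exists 0; rewrite ?rmorph0.
    + by move=> _ _ [x Ix <-] [y Iy <-]; exists (x + y); rewrite ?rmorphD //; apply: ID.
    + move=> a _ [x Ix <-]; exists (phi a * x); first exact: IM.
      by rewrite rmorphM /= p_phi.
  - move=> [x Ix /p_lift [s xE ps]]; apply: I1.
    rewrite rmorph1 in xE; have -> : 1 = x - s by rewrite xE addrK.
    apply: idealB => //; apply: nI; rewrite /n /preimage /= ps.
    by case: m_ideal.
  - by move=> a ma; exists (phi a); rewrite ?p_phi //; apply: nI; rewrite /n /preimage /= p_phi.
by rewrite /n /preimage /= -pI; exists r.
Qed.

Lemma spanmod_split xs r : spanmod R^o (map phi xs) r <->
  spanmod A^o xs (p r) /\ spanmod M xs (q r).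
Proof.
have q0 : q 0 = 0 by apply: (addrI (q 0)); rewrite -qD !addr0.
elim: xs r => [|x xs IHxs] r /=.
  split=> [->|[pr qr]]; first by rewrite rmorph0.
  by apply: pq_inj; rewrite ?rmorph0 ?q0.
split=> [[u [v [/IHxs [pv qv] ->]]]|[[u1 [v1 [sv1 pr]]] [u2 [v2 [sv2 qr]]]]].
  split; first by exists (p u), (p v); rewrite rmorphD rmorphM /= p_phi.
  by exists (q u), (q v); rewrite qD qZ.
have [u [pu qu]] := pq_surj u1 u2; have [v [pv qv]] := pq_surj v1 v2.
exists u, v; split; first by apply/IHxs; rewrite pv qv.
apply: pq_inj; first by rewrite rmorphD rmorphM /= p_phi pu pv.
by rewrite qD qZ qu qv.
Qed.

Lemma regular_split xs :
  regular R^o (map phi xs) <-> regular A^o xs /\ regular M xs.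
Proof.
elim: xs => [|x xs IHxs] //=; split.
  move=> [/IHxs [rA rM] xreg]; split; split=> // y sy.
    have [r [pr qr]] := pq_surj y 0; rewrite -pr in sy *.
    suff /spanmod_split [] : spanmod R^o (map phi xs) r by [].
    apply: xreg; apply/spanmod_split; rewrite rmorphM /= p_phi qZ qr scaler0.
    by split; [exact: sy | exact: spanmod0].
  have [r [pr qr]] := pq_surj 0 y; rewrite -qr in sy *.
  suff /spanmod_split [] : spanmod R^o (map phi xs) r by [].
  apply: xreg; apply/spanmod_split; rewrite rmorphM /= p_phi pr mulr0 qZ.
  by split; [exact: spanmod0 | exact: sy].
move=> [[rA xA] [rM xM]]; split; first exact/IHxs.
move=> r; rewrite !spanmod_split rmorphM /= p_phi qZ => -[pr qr].
by split; [apply: xA | apply: xM].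
Qed.

Lemma chain_of_regular xs : regular A^o xs -> (forall x, x \in xs -> m x) ->
  prime_chain A (size xs).
Proof.
move=> reg xsm; apply/prime_chainP; exists m.
apply: (regular_chain_to Anoeth) => //.
apply: spanmod_sub => // x u /xsm mx; exact: ideal_mulr.
Qed.

Lemma chain_split t : prime_chain A t -> prime_chain R t.
Proof.
move=> [c [cp cs]]; exists (fun i => p @^-1` c i); split=> i it.
  exact/prime_preimage/cp.
have [cc ncc] := cs i it; split; first by move=> r; apply: cc.
by move=> sub; apply: ncc => a ca; have := sub (phi a); rewrite /preimage /= p_phi; apply.
Qed.

Lemma depth_ge_of_regular xs : (forall x, x \in xs -> m x) ->
  regular R^o (map phi xs) ->
  [/\ depth_ge m (A^o : lmodType A) (size xs), depth_ge m M (size xs) &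
      depth_ge n (R^o : lmodType R) (size xs)].
Proof.
move=> xsm regR; have [regA regM] := (regular_split xs).1 regR.
split=> E i ixs; [exact: regular_exact_lt ixs | exact: regular_exact_lt ixs |].
apply: (regular_exact_lt (xs := map phi xs)) => //; last by rewrite size_map.
by move=> _ /mapP [x xxs ->]; rewrite /n /preimage /= p_phi; apply: xsm.
Qed.

Lemma regular_of_depth_split t : depth_ge n (R^o : lmodType R) t ->
  exists xs, [/\ size xs = t, forall x, x \in xs -> m x & regular R^o (map phi xs)].
Proof.
apply: (regular_of_depth Rnoeth m_ideal) => // x mx.
by rewrite /n /preimage /= p_phi.
Qed.

Lemma regular_of_depth_self t : depth_ge m (A^o : lmodType A) t ->
  exists xs, [/\ size xs = t, forall x, x \in xs -> m x & regular A^o xs].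
Proof.
move=> dt; have [||xs [sz xsm]] := @regular_of_depth A A idfun m m Anoeth m_ideal _ _ t dt.
- by [].
- by move=> P _; apply.
by rewrite map_id; exists xs.
Qed.

(** M may fail to be finitely generated, so avoidance is run in R; the components p u and q u of a
    socle element of R / xs R are excluded by the depths of A and M respectively. *)
Lemma regular_of_depths t : depth_ge m (A^o : lmodType A) t -> depth_ge m M t ->
  exists xs, [/\ size xs = t, forall x, x \in xs -> m x & regular R^o (map phi xs)].
Proof.
have [EA] := injective_resolution_ex (A^o : lmodType A).
have [EM] := injective_resolution_ex M.
elim: t => [|t IHt] dA dM; first by exists [::].
have [||xs [sz xsm reg]] := IHt; [exact: depth_ge_leq dA | exact: depth_ge_leq dM |].
have [[x mx xreg]|[u pu mu]] :=
    regular_or_socle phi Rnoeth m_ideal (ideal_span (map phi xs)).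
  exists (x :: xs); split=> //=; first by rewrite sz.
  by move=> y; rewrite in_cons => /orP [/eqP ->|/xsm].
have [regA regM] := (regular_split xs).1 reg.
have [_ u1 _] := pu; case: u1; rewrite /colon /= mul1r.
have mpq a : m a -> spanmod A^o xs (a * p u) /\ spanmod M xs (a *: q u).
  by move/mu/spanmod_split; rewrite rmorphM /= p_phi qZ.
apply/spanmod_split; split.
  apply: (@no_socle _ _ EA _ m) => // [i|a /mpq []//].
  by rewrite sz => it; apply: dA.
apply: (@no_socle _ _ EM _ m) => // [i|a /mpq []//].
by rewrite sz => it; apply: dM.
Qed.

(** The sequence gives a chain of length d up to P; if P were not m, adding m would make it too
    long. *)
Lemma prime_over_regular xs P d : regular A^o xs -> ~ prime_chain A d.+1 ->
  size xs = d -> prime_ideal P -> spanmod A^o xs `<=` P -> m `<=` P.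
Proof.
move=> reg nc sz pP sP; apply: contrapT => nmP; apply: nc.
apply/prime_chainP; exists m; apply/chain_toS; split=> //; exists P.
  by rewrite -sz; apply: (regular_chain_to Anoeth).
by split=> //; apply: local_prime_sub.
Qed.

Lemma split_prime_chain_depth :
  (forall t, prime_chain R t <-> depth_ge n (R^o : lmodType R) t) ->
  forall t, prime_chain A t <-> depth_ge m (A^o : lmodType A) t.
Proof.
move=> cd t; split=> [/chain_split/cd/regular_of_depth_split [xs [<- xsm reg]]|].
  by have [] := depth_ge_of_regular xsm reg.
by move=> /regular_of_depth_self [xs [<- xsm reg]]; apply: chain_of_regular.
Qed.

(** If the depth of M exceeded d = dim A, a regular sequence of length d, which generates an
    m-primary ideal, would force all local cohomology of M to vanish. *)
Lemma split_big_cohen_macaulay : (exists t, ~ depth_ge m M t) ->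
  (forall t, prime_chain R t <-> depth_ge n (R^o : lmodType R) t) ->
  forall t, prime_chain A t <-> depth_ge m M t.
Proof.
move=> [t0 dfin] cd t.
have seq d : prime_chain A d -> exists xs, [/\ size xs = d,
    forall x, x \in xs -> m x & regular R^o (map phi xs)].
  by move=> /chain_split/cd/regular_of_depth_split.
split=> [/seq [xs [<- xsm reg]]|dM]; first by have [] := depth_ge_of_regular xsm reg.
apply: contrapT => nct.
have [d [dt cd' ncd]] := last_true (prime_chain0 m_prime) nct.
have [xs [sz xsm reg]] := seq d cd'; have [regA regM] := (regular_split xs).1 reg.
have [|k mk] := @power_sub_of_primes A m _ Anoeth (ideal_span xs).
  by move=> P pP sP; exact: (prime_over_regular regA ncd sz pP sP).
apply: dfin => E; apply: (regular_exact_all regA regM xsm mk) => i ixs.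
by apply: dM; apply: leq_ltn_trans ixs _; rewrite sz.
Qed.

(** dim R does not exceed d = dim A: a sequence of length d regular on A and M has n as its only
    prime in R, and the height theorem applies. *)
Lemma split_cohen_macaulay :
  (forall t, prime_chain A t <-> depth_ge m (A^o : lmodType A) t) ->
  (forall t, prime_chain A t <-> depth_ge m M t) -> local_ring n ->
  forall t, prime_chain R t <-> depth_ge n (R^o : lmodType R) t.
Proof.
move=> cA cM Rlocal t.
have seq d : prime_chain A d -> exists xs, [/\ size xs = d,
    forall x, x \in xs -> m x & regular R^o (map phi xs)].
  by move=> c; apply: regular_of_depths; [apply/cA | apply/cM].
split=> [ct|/regular_of_depth_split [xs [<- xsm reg]]]; last first.
  apply/chain_split/chain_of_regular => //.
  by have [] := (regular_split xs).1 reg.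
suff /seq [xs [<- xsm reg]] : prime_chain A t by have [] := depth_ge_of_regular xsm reg.
apply: contrapT => nct.
have [d [dt cd ncd]] := last_true (prime_chain0 m_prime) nct.
have [xs [sz xsm reg]] := seq d cd; have [regA regM] := (regular_split xs).1 reg.
have [P cP] := (prime_chainP _ _).1 ct.
have pn := maximal_prime split_maximal.
have cn : chain_to t n.
  apply: (chain_to_sub cP pn); exact: local_prime_sub (chain_to_prime cP).
suff : (t <= size (map phi xs))%N by rewrite size_map sz leqNgt dt.
apply: (height_theorem Rnoeth cn).
  by move=> _ /mapP [x /xsm mx ->]; rewrite /n /preimage /= p_phi.
move=> Q pQ xsQ _; apply: nprime => //.
apply: (@prime_over_regular xs (phi @^-1` Q) d) => //; first exact: prime_preimage.
have [hQ _ _] := prime_preimage phi pQ.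
apply: spanmod_sub => // x u xxs; apply: ideal_mulr => //.
by apply/xsQ/map_f.
Qed.

End SplitExtension.

(** * The amalgamation as a split extension *)

Section Amalgamation.
Variables (A B : comPzRingType) (f : {rmorphism A -> B}) (J : set B) (hJ : ideal J).
Local Notation R := (amalgamation f hJ).
Local Notation M := (ideal_module f hJ).

Lemma amalg_predP (u : A * B) : reflect (J (u.2 - f u.1)) (u \in amalg_pred f J).
Proof.
apply: (iffP idP) => [|Ju].
  by rewrite unfold_in => /set_mem [a _ [j Jj <-]] /=; rewrite addrC addKr.
rewrite unfold_in; apply/mem_set.
by exists u.1 => //; exists (u.2 - f u.1) => //; rewrite addrC subrK -surjective_pairing.
Qed.

Fact amalg_in_subproof (u : A * B) : J (u.2 - f u.1) -> u \in amalg_pred f J.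
Proof. by move/amalg_predP. Qed.

Definition amalg_in u (hu : J (u.2 - f u.1)) : R :=
  exist (fun u => u \in amalg_pred f J) u (amalg_in_subproof hu).

Lemma amalg_diff (r : R) : J ((val r).2 - f (val r).1).
Proof. exact/amalg_predP/(valP r). Qed.

Fact amalg_base_subproof (a : A) : J (f a - f a).
Proof. by rewrite subrr; case: hJ. Qed.

Definition amalg_base a : R := @amalg_in (a, f a) (amalg_base_subproof a).

Lemma amalg_ext (r s : R) : (val r).1 = (val s).1 -> (val r).2 = (val s).2 -> r = s.
Proof.
move=> e1 e2; apply: val_inj.
by rewrite [LHS]surjective_pairing [RHS]surjective_pairing e1 e2.
Qed.

Fact amalg_base_zmod_morphism : GRing.zmod_morphism amalg_base.
Proof. by move=> a b; apply: amalg_ext; rewrite /= ?rmorphB. Qed.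

HB.instance Definition _ := GRing.isZmodMorphism.Build A R amalg_base
  amalg_base_zmod_morphism.

Fact amalg_base_monoid_morphism : GRing.monoid_morphism amalg_base.
Proof. by split=> [|a b]; apply: amalg_ext; rewrite /= ?rmorph1 ?rmorphM. Qed.

HB.instance Definition _ := GRing.isMonoidMorphism.Build A R amalg_base
  amalg_base_monoid_morphism.

Definition amalg_fst (r : R) : A := (val r).1.

Fact amalg_fst_zmod_morphism : GRing.zmod_morphism amalg_fst.
Proof. by []. Qed.

HB.instance Definition _ := GRing.isZmodMorphism.Build R A amalg_fst
  amalg_fst_zmod_morphism.

Fact amalg_fst_monoid_morphism : GRing.monoid_morphism amalg_fst.
Proof. by []. Qed.

HB.instance Definition _ := GRing.isMonoidMorphism.Build R A amalg_fst
  amalg_fst_monoid_morphism.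

Definition mk_ideal_module (x : B) (Jx : J x) : M :=
  exist (fun x => x \in ideal_pred J) x (mem_set Jx).

Definition amalg_ideal (r : R) : M := mk_ideal_module (amalg_diff r).

Fact amalg_of_ideal_subproof (x : B) : J x -> J (x - f 0).
Proof. by rewrite rmorph0 subr0. Qed.

Definition amalg_of_ideal (x : B) (Jx : J x) : R :=
  @amalg_in (0, x) (amalg_of_ideal_subproof Jx).

Lemma amalg_baseK a : amalg_fst (amalg_base a) = a.
Proof. by []. Qed.

Lemma amalg_idealD (r s : R) : amalg_ideal (r + s) = amalg_ideal r + amalg_ideal s.
Proof. by apply: val_inj; rewrite raddfD /= rmorphD opprD addrACA. Qed.

Lemma amalg_idealZ a (r : R) : amalg_ideal (amalg_base a * r) = a *: amalg_ideal r.
Proof. by apply: val_inj; rewrite /= rmorphM mulrBr. Qed.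

Lemma amalg_inj (r s : R) :
  amalg_fst r = amalg_fst s -> amalg_ideal r = amalg_ideal s -> r = s.
Proof.
move=> e1 /(congr1 val) /= e2; apply: amalg_ext => //.
by move: e2; rewrite [(val r).1]e1 => /addIr.
Qed.

Lemma amalg_surj a (y : M) : exists r, amalg_fst r = a /\ amalg_ideal r = y.
Proof.
have Jy : J (f a + val y - f a) by rewrite addrC addKr; apply: set_mem (valP y).
exists (@amalg_in (a, f a + val y) Jy); split=> //.
by apply: val_inj; rewrite /= addrC addKr.
Qed.

(** If (0, x) with x in J were outside P, the b with (0, b x) in P would form a prime of B that
    misses x and lies over m, which is excluded. So P contains all (0, j), and these together with
    the image of m make up the preimage of m. *)
Lemma amalg_primes (m : set A) : maximal_ideal m ->
  (forall q : set B, (Spec B `\` Vset J) q -> f @^-1` q <> m) ->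
  forall P, prime_ideal P -> (forall x, m x -> P (amalg_base x)) ->
  amalg_fst @^-1` m `<=` P.
Proof.
move=> [_ m1 mmax] fq P pP mP; have [hP P1 PM] := pP; have [P0 PD PZ] := hP.
have JP x (Jx : J x) : P (amalg_of_ideal Jx).
  apply: contrapT => Px; pose z := amalg_of_ideal Jx.
  have JB b : J (b * x) by case: hJ => _ _; apply.
  pose q : set B := [set b | P (amalg_of_ideal (JB b))].
  have pq : prime_ideal q.
    split; first split; rewrite /q /=.
    - have -> : amalg_of_ideal (JB 0) = 0 by apply: amalg_ext; rewrite /= ?mul0r.
      exact: P0.
    - move=> b c Pb Pc; have -> : amalg_of_ideal (JB (b + c)) =
        amalg_of_ideal (JB b) + amalg_of_ideal (JB c).
        by apply: amalg_ext; rewrite /= ?mulrDl ?addr0.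
      exact: PD.
    - move=> b c Pc; suff : P (amalg_of_ideal (JB (b * c)) * amalg_of_ideal (JB (b * c))).
        by case/PM.
      (* B need not act on P, but (0, b c x)^2 = (0, c x) (0, b^2 c x). *)
      have -> : amalg_of_ideal (JB (b * c)) * amalg_of_ideal (JB (b * c)) =
          amalg_of_ideal (JB (b * b * c)) * amalg_of_ideal (JB c).
        by apply: amalg_ext; rewrite /= ?mul0r //; ring.
      exact: PZ.
    - have -> : amalg_of_ideal (JB 1) = z by apply: amalg_ext; rewrite /= ?mul1r.
      exact: Px.
    - move=> b c Pbc; apply: PM.
      have -> : amalg_of_ideal (JB b) * amalg_of_ideal (JB c) =
          z * amalg_of_ideal (JB (b * c)).
        by apply: amalg_ext; rewrite /= ?mul0r //; ring.
      exact: PZ.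
  apply: (fq q).
    split=> // -[_ Jq]; have : q x by apply: Jq.
    have -> : q x = P (z * z).
      by congr P; apply: amalg_ext; rewrite /= ?mul0r.
    by case/PM.
  apply: mmax.
  - by case: (prime_preimage f pq).
  - by rewrite /preimage /= rmorph1; case: pq.
  - move=> a /mP Pa; rewrite /preimage /q /=.
    have -> : amalg_of_ideal (JB (f a)) = z * amalg_base a.
      by apply: amalg_ext; rewrite /= ?mul0r // mulrC.
    exact: PZ.
move=> r mr.
have -> : r = amalg_base (amalg_fst r) + amalg_of_ideal (amalg_diff r).
  by apply: amalg_ext; rewrite /= ?addr0 // addrC subrK.
by apply: PD; [apply: mP | apply: JP].
Qed.

(** An element r whose first component is outside m is a unit: after scaling the first component to
    1, the second is 1 + j with j in the Jacobson radical of B. *)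
Lemma amalg_local (m : set A) : local_ring m -> J `<=` jacobson_radical B ->
  local_ring (amalg_fst @^-1` m).
Proof.
move=> lm Jrad; have [mmax mu] := lm; have [hm m1 _] := mmax.
have nmax := split_maximal (phi := amalg_base) (p := amalg_fst) amalg_baseK lm.
split=> // P maxP; have [hP P1 Pmax] := maxP; have [_ _ PZ] := hP.
apply/esym/Pmax; [by case: nmax | by case: nmax |] => r Pr.
apply: contrapT => mr.
have [c cr] : exists c, c * amalg_fst r = 1.
  apply: contrapT => nc.
  have [||n maxn rn] := @maximal_ex A (adjoin [set 0] (amalg_fst r)).
  - apply: adjoin_ideal; split=> // [_ _ -> ->|a _ ->]; by rewrite ?addr0 ?mulr0.
  - by move=> [i [c [-> ce]]]; apply: nc; exists c; rewrite ce add0r.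
  apply: mr; rewrite /preimage /= -(mu _ maxn); apply: rn.
  by exists 0, 1; rewrite add0r mul1r.
pose s := amalg_base c * r.
have Ps : P s by apply: PZ.
have s1 : amalg_fst s = 1 by rewrite rmorphM /= amalg_baseK.
pose j := (val s).2 - 1.
have Jj : J j by have := amalg_diff s; rewrite [(val s).1]s1 rmorph1.
have [u us] : exists u, u * (val s).2 = 1.
  apply: contrapT => nu.
  have [||n maxn sn] := @maximal_ex B (adjoin [set 0] (val s).2).
  - apply: adjoin_ideal; split=> // [_ _ -> ->|a _ ->]; by rewrite ?addr0 ?mulr0.
  - by move=> [i [c' [-> ce]]]; apply: nu; exists c'; rewrite ce add0r.
  have [hn n1 _] := maxn; apply: n1.
  have -> : 1 = (val s).2 - j by rewrite /j opprB addrC subrK.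
  apply: idealB => //; last exact: (Jrad _ Jj).
  by apply: sn; exists 0, 1; rewrite add0r mul1r.
(* The inverse (1, u) belongs to the amalgamation because u - 1 = - u j. *)
have Ju : J (u - f 1).
  have -> : u - f 1 = - u * j by rewrite rmorph1 /j mulNr mulrBr us mulr1 opprB.
  by case: hJ => _ _; apply.
apply: P1; have -> : 1 = @amalg_in (1, u) Ju * s.
  apply: amalg_ext; first by rewrite /= mul1r; apply/esym.
  by rewrite /= us.
exact: PZ.
Qed.

End Amalgamation.

Theorem theorem2p3 (A B : comPzRingType) (m : set A) (f : {rmorphism A -> B})
    (J : set B) (hJ : ideal J) :
  noetherian A -> local_ring m ->
  J `<=` jacobson_radical B ->
  noetherian (amalgamation f hJ) ->
  (forall q : set B, (Spec B `\` Vset J) q -> f @^-1` q <> m) ->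
  (cohen_macaulay (amalgamation f hJ) -> cohen_macaulay A) /\
  (depth m (ideal_module f hJ) <> +oo%E ->
   (cohen_macaulay (amalgamation f hJ) <->
    cohen_macaulay A /\ big_cohen_macaulay m (ideal_module f hJ))).
Proof.
move=> Anoeth lm Jrad Rnoeth fq.
pose R : comPzRingType := amalgamation f hJ.
pose M : lmodType A := ideal_module f hJ.
pose n : set R := @amalg_fst A B f J hJ @^-1` m.
have [mmax mu] := lm; have mprime := maximal_prime mmax.
have phiK := amalg_baseK f hJ; have qD := @amalg_idealD A B f J hJ.
have qZ := @amalg_idealZ A B f J hJ; have pq_inj := @amalg_inj A B f J hJ.
have pq_surj := @amalg_surj A B f J hJ.
have nprime := @amalg_primes A B f J hJ m mmax fq.
have nmax : maximal_ideal n := split_maximal phiK lm.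
have cmA : cohen_macaulay A <->
    forall t, prime_chain A t <-> depth_ge m (A^o : lmodType A) t.
  rewrite -(depth_eq_dim _ _ (prime_chain0 mprime)); split; last by split=> //; exists m.
  by move=> [_ [m' [[/mu -> _] <-]]].
(* [cohen_macaulay] includes locality, and n is maximal, so it is the maximal ideal in question. *)
have cmR : cohen_macaulay R <-> local_ring n /\
    forall t, prime_chain R t <-> depth_ge n (R^o : lmodType R) t.
  rewrite -(depth_eq_dim _ _ (prime_chain0 (maximal_prime nmax))); split.
    by move=> [_ [n' [ln dn]]]; have [_ /(_ n nmax) ->] := ln.
  by move=> [ln dn]; split=> //; exists n.
have bcm : big_cohen_macaulay m M <-> forall t, prime_chain A t <-> depth_ge m M t.
  by rewrite -(depth_eq_dim _ _ (prime_chain0 mprime)).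
have part1 : cohen_macaulay R -> cohen_macaulay A.
  move=> /cmR [_ cd]; apply/cmA.
  exact: (split_prime_chain_depth phiK qD qZ pq_inj pq_surj Anoeth Rnoeth lm nprime cd).
split=> // /depth_finite dfin; split=> [cR|[/cmA cA /bcm cM]].
  split; first exact: part1.
  have [_ cd] := cmR.1 cR; apply/bcm.
  exact: (split_big_cohen_macaulay phiK qD qZ pq_inj pq_surj Anoeth Rnoeth lm nprime dfin cd).
have ln : local_ring n := @amalg_local A B f J hJ m lm Jrad.
apply/cmR; split=> //.
exact: (split_cohen_macaulay phiK qD qZ pq_inj pq_surj Anoeth Rnoeth lm nprime cA cM ln).
Qed.
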